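(* (i) Exact identification of Boolean functions of $n$ variables that are read-once over the basis $\mathcal M$ of all monotone threshold functions, using membership and subcube identity queries, requires a number of queries exponential in $n$ in the worst case. (ii) For every finite subset $\mathcal B\subseteq\mathcal M$ there is a polynomial $P$ such that Boolean functions of $n$ variables read-once over $\mathcal B$ can be exactly identified with at most $P(n)$ membership and subcube identity queries.
   Context: A threshold function is a Boolean function $f(x_1,\ldots,x_m)$ with $f(x)=1\iff\alpha_1x_1+\cdots+\alpha_mx_m\ge\alpha_0$ for some reals $\alpha_i$; it is monotone threshold if this holds with $\alpha_1,\ldots,\alpha_m\ge0$. A formula over a basis $\mathcal B$ is read-once if every variable occurs in it exactly once; a Boolean function of $X=\{x_1,\ldots,x_n\}$ is read-once over $\mathcal B$ if it is expressible by such a formula (other variables of $X$ are fictitious). A partial assignment $p$ is a map $X\to\{0,1,*\}$; the projection $f_p$ is the function of $p^{-1}( * )$ obtained by fixing the other variables to their values under $p$. A membership query takes a total assignment $a$ and returns $f(a)$; a subcube identity query takes a partial assignment $p$ and returns ''yes'' iff $f_p\equiv0$ or $f_p\equiv1$. Exact identification: a deterministic algorithm, knowing the basis and $X$, adaptively queries the unknown target from the class and must determine it; complexity is the worst-case number of queries, as a function of $n$. *)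

(* Defs.v *)
From HB Require Import structures.
From mathcomp Require Import all_boot all_order all_algebra.
From mathcomp Require Import boolp classical_sets cardinality reals.

Set Implicit Arguments.
Unset Strict Implicit.
Unset Printing Implicit Defensive.

Import Order.TTheory GRing.Theory Num.Theory.
Local Open Scope ring_scope.

Definition assignment (n : nat) := {ffun 'I_n -> bool}.

Definition boolfun (n : nat) := {ffun assignment n -> bool}.

(* A Boolean function together with its arity.  Arity 0 is allowed, so that the
   constants may also occur as nullary gates. *)
Definition gate := {m : nat & boolfun m}.

Definition threshold_weights (R : realType) (m : nat) (g : boolfun m)
    (a0 : R) (a : 'I_m -> R) : Prop :=
  forall x : assignment m, g x <-> a0 <= \sum_(i < m) a i * (x i)%:R.

Definition monotone_threshold (R : realType) : set gate :=
  fun g => exists (a0 : R) (a : 'I_(tag g) -> R),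
    (forall i, 0 <= a i) /\ threshold_weights (tagged g) a0 a.

Inductive formula (B : set gate) (n : nat) : Type :=
| Var of 'I_n
| App (g : gate) of B g & ('I_(tag g) -> formula B n).

Fixpoint eval (B : set gate) (n : nat) (F : formula B n) (x : assignment n)
    : bool :=
  match F with
  | Var i => x i
  | App g _ Fs => tagged g [ffun i => eval (Fs i) x]
  end.

(* The variable occurrences of a formula, with repetitions. *)
Fixpoint occurrences (B : set gate) (n : nat) (F : formula B n) : seq 'I_n :=
  match F with
  | Var i => [:: i]
  | App g _ Fs => flatten [seq occurrences (Fs i) | i <- enum 'I_(tag g)]
  end.

(* A variable of 'I_n that does not occur in F is a fictitious variable of f. *)
Definition read_once (B : set gate) (n : nat) : set (boolfun n) :=
  fun f => exists F : formula B n,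
    uniq (occurrences F) /\ (forall x, f x = eval F x).

Arguments read_once B n : clear implicits.

(* None stands for the star. *)
Definition partial_assignment (n : nat) := {ffun 'I_n -> option bool}.

Definition free_var (n : nat) (p : partial_assignment n) :=
  {i : 'I_n | p i == None}.

(* [insub i] is [Some j], with [val j = i], exactly when [p i = None]. *)
Definition fill (n : nat) (p : partial_assignment n)
    (y : {ffun free_var p -> bool}) : assignment n :=
  [ffun i => if (insub i : option (free_var p)) is Some j then y j
             else p i == Some true].

Definition projection (n : nat) (f : boolfun n) (p : partial_assignment n) :
    {ffun {ffun free_var p -> bool} -> bool} :=
  [ffun y => f (fill y)].

Inductive query (n : nat) : Type :=
| Membership of assignment n
| SubcubeIdentity of partial_assignment n.

Definition answer (n : nat) (f : boolfun n) (q : query n) : bool :=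
  match q with
  | Membership a => f a
  | SubcubeIdentity p =>
      (projection f p == [ffun=> false]) || (projection f p == [ffun=> true])
  end.

(* Only queries are counted, so a deterministic adaptive algorithm is a decision
   tree: the next query depends on the answers received so far.  The tree may be
   chosen knowing the class and the number of variables. *)
Inductive algorithm (n : nat) : Type :=
| Output of boolfun n
| Ask of query n & (bool -> algorithm n).

Fixpoint run (n : nat) (A : algorithm n) (f : boolfun n) : boolfun n :=
  match A with
  | Output h => h
  | Ask q next => run (next (answer f q)) f
  end.

Fixpoint num_queries (n : nat) (A : algorithm n) (f : boolfun n) : nat :=
  match A with
  | Output _ => 0
  | Ask q next => (num_queries (next (answer f q)) f).+1
  end.

Definition exactly_identifies (n : nat) (A : algorithm n)
    (C : set (boolfun n)) : Prop :=
  forall f, C f -> run A f = f.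

(* Main.v *)
(* Lower bound: the threshold function [at least k + 1 ones] and its
   modifications accepting one extra point with exactly k ones are all monotone
   threshold functions, and each query separates the former from at most two of
   the latter.

   Upper bound: only the bound l on the arity of the gates matters. For read-once
   f depending on all variables of a set W (and maybe others), the variables
   outside W can be fixed so that dependence on all of W is kept; in a threshold
   gate this follows by making its lightest variable of W pivotal. Two read-once
   functions with the same relevant variables are equal as soon as, for every W of
   size O(l^2), they agree on one subcube on which they depend on all of W: a
   bottom gate of the one is recognised as a module of the other, and is
   collapsed. Consequently, if a restriction h of f, with exactly T as relevant
   variables, is known, then freeing one more variable t is learned with
   polynomially many membership queries on subcubes chosen from h. Starting from
   a constant restriction, one raises the fixed variables to 1 one by one, then
   lowers them to 0, enlarging T as soon as a variable turns out to matter; if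
   none does, f = h by monotonicity. *)
Require Import Defs.
From HB Require Import structures.
From mathcomp Require Import all_boot all_order all_algebra.
From mathcomp Require Import boolp classical_sets cardinality reals.
(* The names of [classical_sets] shadow those of [finset]. *)
From mathcomp Require Import fintype finset.
From mathcomp Require Import zify lra.

Set Implicit Arguments.
Unset Strict Implicit.
Unset Printing Implicit Defensive.

Import Order.TTheory GRing.Theory Num.Theory.
Local Open Scope ring_scope.

(** * Assignments and subcubes *)

Lemma exists_choice (X Y : Type) (P : X -> Y -> Prop) :
  (forall x, exists y, P x y) -> exists f, forall x, P x (f x).
Proof. by move=> /boolp.choice[f]; exists f. Qed.

Lemma monotone_bool_id (u : bool -> bool) e :
  (u false -> u true) -> u false != u true -> u e = e.
Proof. by case: e; case: (u false); case: (u true) => // /(_ isT). Qed.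

Section Cube.
Variable n : nat.
Implicit Types (x y z q : assignment n) (f : assignment n -> bool).
Implicit Types (S T W V : {set 'I_n}).

Definition upd y (i : 'I_n) (e : bool) : assignment n :=
  [ffun j => if j == i then e else y j].

Definition override S x y : assignment n :=
  [ffun j => if j \in S then x j else y j].

Definition eq_off W x y := forall j, j \notin W -> x j = y j.

Definition pivotal f i y := f (upd y i false) != f (upd y i true).

Definition relevant f i := exists y, pivotal f i y.

Definition supported T f :=
  forall x y, (forall j, j \in T -> x j = y j) -> f x = f y.

Definition monotone f := forall x y, (forall j, x j -> y j) -> f x -> f y.

(* [f] depends on every variable of [W] once the variables outside [W] are
   fixed as in [q]. *)
Definition depends_on f W q :=
  forall w, w \in W -> exists2 y, eq_off W y q & pivotal f w y.

Lemma upd_same y i : upd y i (y i) = y.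
Proof. by apply/ffunP=> j; rewrite ffunE; case: eqP => [->|]. Qed.

Lemma upd_idem y i e : y i = e -> upd y i e = y.
Proof. by move<-; exact: upd_same. Qed.

Lemma upd_upd y i e e' : upd (upd y i e) i e' = upd y i e'.
Proof. by apply/ffunP=> j; rewrite !ffunE; case: eqP. Qed.

Lemma upd_comm y i j e e' : i != j ->
  upd (upd y i e) j e' = upd (upd y j e') i e.
Proof.
move=> ij; apply/ffunP=> k; rewrite !ffunE.
by case: (k =P j) => // ->; rewrite eq_sym (negPf ij).
Qed.

Lemma updE y i e : upd y i e i = e.
Proof. by rewrite ffunE eqxx. Qed.

Lemma upd_neq y i j e : j != i -> upd y i e j = y j.
Proof. by move=> ji; rewrite ffunE (negPf ji). Qed.

Lemma overrideE S x y j : j \in S -> override S x y j = x j.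
Proof. by move=> jS; rewrite ffunE jS. Qed.

Lemma override_off S x y : eq_off S (override S x y) y.
Proof. by move=> j jS; rewrite ffunE (negPf jS). Qed.

Lemma override_id S x : override S x x = x.
Proof. by apply/ffunP=> j; rewrite ffunE if_same. Qed.

Lemma eq_off_trans W y x z : eq_off W x y -> eq_off W y z -> eq_off W x z.
Proof. by move=> h h' j jW; rewrite h // h'. Qed.

Lemma eq_offS W V x y : W \subset V -> eq_off W x y -> eq_off V x y.
Proof. by move=> /subsetP WV h j jV; apply: h; apply: contra jV; apply: WV. Qed.

Lemma eq_off_upd W y q w e : w \in W -> eq_off W y q -> eq_off W (upd y w e) q.
Proof.
move=> wW yq j jW; rewrite ffunE; case: eqP => [jw|_]; last exact: yq.
by rewrite jw wW in jW.
Qed.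

Lemma eq_off_override S W a y q :
  S \subset W -> eq_off W y q -> eq_off W (override S a y) q.
Proof.
move=> SW yq; apply: eq_off_trans yq; apply: eq_offS SW _.
exact: override_off.
Qed.

Lemma eq_depends_on f f' W q : f =1 f' -> depends_on f W q -> depends_on f' W q.
Proof. by move=> e d w /d [y yq p]; exists y => //; rewrite /pivotal -!e. Qed.

Lemma depends_on_agree f f' W q : (forall y, eq_off W y q -> f y = f' y) ->
  depends_on f W q -> depends_on f' W q.
Proof.
move=> e d w wW; have [y yq p] := d w wW; exists y => //.
by rewrite /pivotal -!e //; exact: eq_off_upd.
Qed.

Lemma pivotal_neq f i y e e' :
  f (upd y i e) != f (upd y i e') -> pivotal f i y.
Proof. by rewrite /pivotal; case: e; case: e'; rewrite ?eqxx // eq_sym. Qed.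

(** [x] is turned into [y] one coordinate at a time, by induction on the number of coordinates where
    they differ; none of these is relevant. *)
Lemma relevant_supported f x y : (forall i, relevant f i -> x i = y i) ->
  f x = f y.
Proof.
have [k] := ubnP #|[set i | x i != y i]|; elim: k x => // k IH x.
have [e|[i]] := set_0Vmem [set i | x i != y i].
  move=> _ _; congr f; apply/ffunP=> i; apply/eqP/negbFE.
  by have := in_set0 i; rewrite -e inE.
rewrite inE => xyi cx rxy; have nri : ~ relevant f i.
  by move=> /rxy E; rewrite E eqxx in xyi.
have -> : f x = f (upd x i (y i)).
  apply/eqP; apply: contra_notT nri => fx; exists x.
  by apply: (@pivotal_neq _ _ _ (x i) (y i)); rewrite upd_same.
apply: IH => [|j rj]; last first.
  by rewrite ffunE; case: eqP => [->//|_]; apply: rxy.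
rewrite ltnS in cx; apply: leq_trans cx; apply: proper_card.
apply/properP; split; last by exists i; rewrite inE ?xyi // updE eqxx.
by apply/subsetP=> j; rewrite !inE ffunE; case: (j =P i) => // ->; rewrite eqxx.
Qed.

Lemma supported_relevant T f i : supported T f -> relevant f i -> i \in T.
Proof.
move=> sT [y]; apply: contraNT => iT; apply/eqP/sT => j jT.
by rewrite !ffunE; case: eqP => // ji; rewrite -ji jT in iT.
Qed.

Lemma monotone_pivotal f i y : monotone f -> pivotal f i y ->
  forall e, f (upd y i e) = e.
Proof.
move=> mf p e; apply: (@monotone_bool_id (fun e => f (upd y i e))) => //.
by apply: mf => j; rewrite !ffunE; case: eqP.
Qed.

(** Used to drive a subformula to a wanted value inside a subcube on which it depends on at least
    one variable. *)
Lemma depends_on_values f W q w : w \in W -> depends_on f W q ->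
  forall e, exists2 y, eq_off W y q & f y = e.
Proof.
move=> wW d e; have [y yq] := d w wW; rewrite /pivotal => p.
have [E|E] := eqVneq (f (upd y w false)) e.
  by exists (upd y w false) => //; exact: eq_off_upd.
exists (upd y w true); first exact: eq_off_upd.
by move: p E; case: (f _); case: (f _); case: e.
Qed.

End Cube.

(** * Monotone threshold gates *)

Section Threshold.
Variables (R : realType) (m : nat).
Implicit Types (g : boolfun m) (y : assignment m) (W : {set 'I_m}).

Definition threshold_gate g :=
  exists (a0 : R) (a : 'I_m -> R),
    (forall i, 0 <= a i) /\ threshold_weights g a0 a.

Lemma weight_upd (a : 'I_m -> R) y i e :
  \sum_(j < m) a j * (upd y i e j)%:R =
  \sum_(j < m) a j * (upd y i false j)%:R + (if e then a i else 0).
Proof.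
rewrite (bigD1 i) //= [in RHS](bigD1 i) //= !updE mulr0 add0r addrC.
congr (_ + _); last by case: e; rewrite ?mulr1 ?mulr0.
by apply: eq_bigr => j ji; rewrite !upd_neq.
Qed.

Lemma threshold_monotone g : threshold_gate g -> monotone g.
Proof.
move=> [a0 [a [a_ge0 ga]]] x y xy /ga wx; apply/ga; apply: le_trans wx _.
apply: ler_sum => i _; apply: ler_wpM2l => //; rewrite ler_nat.
by have := xy i; case: (x i) => // ->.
Qed.

(* When the lightest variable of [W] is pivotal at [y], so is every other one,
   for one of the two values of the lightest variable. *)
Lemma threshold_depends_on g W : threshold_gate g ->
  (forall i, i \in W -> relevant g i) -> exists q, depends_on g W q.
Proof.
move=> tg rW; have mg := threshold_monotone tg.
have [a0 [a [a_ge0 ga]]] := tg.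
have [->|[i1 i1W]] := set_0Vmem W.
  by exists [ffun=> false] => w; rewrite inE.
pose i0 := [arg min_(i < i1 in W) a i]%O.
have [i0W i0min] : i0 \in W /\ forall j, j \in W -> a i0 <= a j.
  by rewrite /i0; case: arg_minP.
have [y py] := rW _ i0W; have gy := monotone_pivotal mg py.
exists y => j jW; have [->|ji] := eqVneq j i0; first by exists y.
(* Exchange of [j] with the lightest variable: the point with [i0] at 1 and [j] at 0 weighs at most
   as much as the one with [i0] at 0 and [j] at 1, and one of the two lies on the line through [y]
   where [g] reads [i0]. *)
case yj : (y j); [exists (upd y i0 true)|exists (upd y i0 false)];
  rewrite /pivotal //; try exact: eq_off_upd.
- rewrite [upd _ j true]upd_idem ?upd_neq // gy eqb_id.
  apply/negP => /ga le; have /negP := negbT (gy false); apply; apply/ga.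
  rewrite -[upd y i0 false](@upd_idem _ _ j true) ?upd_neq // weight_upd.
  apply: le_trans le _; rewrite upd_comm 1?eq_sym // weight_upd.
  by rewrite upd_comm // lerD2l i0min.
- rewrite [upd _ j false]upd_idem ?upd_neq // gy eq_sym eqbF_neg negbK; apply/ga.
  have /ga := gy true; move/le_trans; apply.
  rewrite weight_upd [leRHS]weight_upd.
  by rewrite [upd _ j false]upd_idem ?upd_neq // lerD2l i0min.
Qed.

(** Fixed inputs stay as inputs of weight 0 and their contribution is subtracted from the threshold,
    so the arity does not change. *)
Lemma threshold_restrict g (k : 'I_m -> option bool) : threshold_gate g ->
  threshold_gate [ffun z : assignment m => g [ffun i => odflt (z i) (k i)]].
Proof.
move=> [a0 [a [a_ge0 ga]]].
exists (a0 - \sum_i (if k i is Some b then a i * b%:R else 0)).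
exists (fun i => if k i is Some _ then 0 else a i); split.
  by move=> i; case: (k i).
move=> z; rewrite ffunE; apply: (iff_trans (ga _)).
rewrite lerBlDr -big_split /=.
suff -> : \sum_i a i * ([ffun i => odflt (z i) (k i)] i)%:R =
  \sum_i ((if k i is Some _ then 0 else a i) * (z i)%:R +
          (if k i is Some b then a i * b%:R else 0)) by [].
apply: eq_bigr => i _; rewrite ffunE.
by case: (k i) => [b|] /=; rewrite ?mul0r ?add0r ?addr0.
Qed.

End Threshold.

(** * Reduced read-once functions *)

Section ReadOnce.
Variables (R : realType) (l n : nat).
Implicit Types (x y z q : assignment n) (f : assignment n -> bool).
Implicit Types (S T U W V : {set 'I_n}).

(* Read-once functions presented by a reduced formula: every gate depends on all
   of its active inputs [J], and [T] is exactly the set of relevant variables. *)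
Inductive reduced : {set 'I_n} -> (assignment n -> bool) -> Prop :=
| ReducedVar T f i : T = [set i] -> (forall x, f x = x i) -> reduced T f
| ReducedGate T f m (g : boolfun m) (J : {set 'I_m})
    (T_ : 'I_m -> {set 'I_n}) (f_ : 'I_m -> assignment n -> bool) :
    (m <= l)%N -> threshold_gate R g -> (forall i, i \in J <-> relevant g i) ->
    J != set0 -> (forall i, i \in J -> reduced (T_ i) (f_ i)) ->
    (forall i j, i \in J -> j \in J -> i != j -> [disjoint T_ i & T_ j]) ->
    T = \bigcup_(i in J) T_ i -> (forall x, f x = g [ffun i => f_ i x]) ->
    reduced T f.

(** A restriction of a reduced function may be constant, which no reduced function is, and may lose
    relevant variables; hence the disjunction and the inclusion in [U]. *)
Definition trivial_or_reduced U f :=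
  (exists b, forall x, f x = b) \/
  (exists2 T : {set 'I_n}, T \subset U & reduced T f).

Section Glue.
Variables (m : nat) (J : {set 'I_m}) (T_ : 'I_m -> {set 'I_n}).
Hypothesis disjT : forall i j, i \in J -> j \in J -> i != j ->
  [disjoint T_ i & T_ j].

(** The active blocks being disjoint, at most one index can be picked for each variable. *)
Definition glue (y_ : 'I_m -> assignment n) q : assignment n :=
  [ffun t => if [pick i | (i \in J) && (t \in T_ i)] is Some i then y_ i t
             else q t].

Lemma block_unique i j t : i \in J -> j \in J -> t \in T_ i -> t \in T_ j ->
  i = j.
Proof.
move=> iJ jJ ti tj; apply/eqP/negPn/negP => /(disjT iJ jJ) d.
by rewrite (disjointFr d ti) in tj.
Qed.

Lemma glueE (y_ : 'I_m -> assignment n) q i t :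
  i \in J -> t \in T_ i -> glue y_ q t = y_ i t.
Proof.
move=> iJ ti; rewrite ffunE; case: pickP => [j /andP[jJ tj]|/(_ i)].
  by rewrite (block_unique iJ jJ ti tj).
by rewrite iJ ti.
Qed.

Lemma glue_off (y_ : 'I_m -> assignment n) q W :
  (forall i, i \in J -> eq_off W (y_ i) q) ->
  eq_off W (glue y_ q) q.
Proof.
by move=> h t tW; rewrite ffunE; case: pickP => // i /andP[iJ _]; apply: h.
Qed.

End Glue.

Lemma gate_agree m (g : boolfun m) (J : {set 'I_m}) (u v : assignment m) :
  (forall i, i \in J <-> relevant g i) -> (forall i, i \in J -> u i = v i) ->
  g u = g v.
Proof. by move=> Jrel uv; apply: relevant_supported => i /Jrel /uv. Qed.

Lemma reduced_ext T f f' : f =1 f' -> reduced T f -> reduced T f'.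
Proof.
move=> e rf; case: rf e => {T f}
  [T f i -> fi|T f m g J T_ f_ ml tg Jrel J0 rf dT -> fE] e.
  by apply: (@ReducedVar _ _ i) => // x; rewrite -e.
by apply: (@ReducedGate _ _ m g J T_ f_) => // x; rewrite -e.
Qed.

Lemma reduced_nonempty T f : reduced T f -> exists t, t \in T.
Proof.
elim=> [{}T {}f i -> _|{}T {}f m g J T_ f_ _ _ _ /set0Pn[i iJ] _ IH _ -> _].
  by exists i; rewrite inE.
by have [t ti] := IH _ iJ; exists t; apply/bigcupP; exists i.
Qed.

Lemma reduced_monotone T f : reduced T f -> monotone f.
Proof.
elim=> [{}T {}f i _ fi|{}T {}f m g J T_ f_ _ tg Jrel _ _ IH _ _ fE] x y xy.
  by rewrite !fi; apply: xy.
(* Nothing is known of [f_ i] for an inactive [i], so these inputs are first set to 0. *)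
rewrite !fE (@gate_agree _ _ _ _ [ffun i => (i \in J) && f_ i x] Jrel); last first.
  by move=> i iJ; rewrite !ffunE iJ.
apply: (threshold_monotone tg) => i; rewrite !ffunE => /andP[iJ].
exact: IH.
Qed.

Lemma reduced_supported T f : reduced T f -> supported T f.
Proof.
elim=> [{}T {}f i -> fi|{}T {}f m g J T_ f_ _ _ Jrel _ _ IH _ -> fE] x y xy.
  by rewrite !fi xy // inE.
rewrite !fE; apply: (gate_agree Jrel) => i iJ; rewrite !ffunE.
by apply: IH => // t ti; apply: xy; apply/bigcupP; exists i.
Qed.

(** Flipping [w] changes, among the active inputs, only that of its own block, so a flip that
    changes [f] changes [f_ i]; off [T_ i] the point can be reset to [q] unnoticed by [f_ i]. *)
Lemma depends_on_block m (g : boolfun m) (J : {set 'I_m})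
    (T_ : 'I_m -> {set 'I_n}) (f_ : 'I_m -> assignment n -> bool) f W q i :
  (forall i, i \in J <-> relevant g i) ->
  (forall i j, i \in J -> j \in J -> i != j -> [disjoint T_ i & T_ j]) ->
  (forall i, i \in J -> supported (T_ i) (f_ i)) ->
  (forall x, f x = g [ffun i => f_ i x]) ->
  i \in J -> depends_on f W q -> depends_on (f_ i) (W :&: T_ i) q.
Proof.
move=> Jrel dT sf fE iJ dW w; rewrite inE => /andP[wW wi].
have [y yq pfy] := dW w wW; exists (override (T_ i) y q).
  move=> t; rewrite inE ffunE; case: ifP => // ti; rewrite andbT; exact: yq.
apply: contraNneq (pfy : pivotal f w y) => E; apply/eqP; rewrite !fE.
apply: (gate_agree Jrel) => j jJ; rewrite !ffunE.
have [->|ji] := eqVneq j i; last first.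
  apply: sf => // t tj; rewrite !ffunE; case: eqP => // tw.
  by rewrite tw in tj; rewrite (block_unique dT jJ iJ tj wi) eqxx in ji.
have fo e : f_ i (upd y w e) = f_ i (upd (override (T_ i) y q) w e).
  by apply: sf => // t ti; rewrite !ffunE ti.
by rewrite !fo.
Qed.

(** Structural induction. The threshold lemma gives a fixing [p] of the inputs outside [K], the
    blocks that meet [W], such that [g] still depends on all of [K]. Blocks missing [W] are driven
    to their value in [p]; those in [K] are fixed by induction. *)
Lemma reduced_depends_on T f W : reduced T f -> W \subset T ->
  exists q, depends_on f W q.
Proof.
move=> rf; elim: rf W => {T f}
  [T f i -> fi|T f m g J T_ f_ ml tg Jrel J0 rf IH dT -> fE] W WT.
  exists [ffun=> false] => w /(subsetP WT); rewrite inE => /eqP ->.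
  by exists [ffun=> false] => //; rewrite /pivotal !fi !updE.
have sf i : i \in J -> supported (T_ i) (f_ i).
  by move=> iJ; apply: reduced_supported (rf i iJ).
pose K := [set i in J | W :&: T_ i != set0].
have KJ : K \subset J by apply/subsetP=> i; rewrite inE => /andP[].
have [p dp] : exists p, depends_on g K p.
  by apply: threshold_depends_on tg _ => i /(subsetP KJ) /Jrel.
have /exists_choice[q_ Hq] : forall i : 'I_m, exists q, i \in J ->
    depends_on (f_ i) (W :&: T_ i) q /\ (i \notin K -> f_ i q = p i).
  move=> i; case: (boolP (i \in J)) => [iJ|_]; last first.
    by exists [ffun=> false].
  case: (boolP (i \in K)) => [iK|iK].
    have [q dq] := IH i iJ (W :&: T_ i) (subsetIr _ _).
    by exists q.
  have [t ti] := reduced_nonempty (rf i iJ).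
  have [q dq] := IH i iJ [set t] ltac:(by rewrite sub1set).
  have [y _ fy] := depends_on_values (set11 t) dq (p i).
  exists y => _; split=> // w; move: iK; rewrite inE iJ /= negbK => /eqP ->.
  by rewrite inE.
exists (glue J T_ q_ [ffun=> false]) => w wW.
have /bigcupP[i iJ wi] := subsetP WT w wW.
have iK : i \in K.
  by rewrite inE iJ; apply/set0Pn; exists w; rewrite inE wW.
have [z zp gz] := dp i iK.
(* Block [i] is moved to a point where [w] is pivotal, the others to the values [z j] at which [g]
   reads input [i]. Since [z] equals [p] off [K], only variables of [W] have to move. *)
have /exists_choice[y_ Hy] : forall j : 'I_m, exists y, j \in J ->
    eq_off (W :&: T_ j) y (q_ j) /\
    (if j == i then pivotal (f_ i) w y : Prop else f_ j y = z j).
  move=> j; case: (boolP (j \in J)) => [jJ|_]; last first.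
    by exists [ffun=> false].
  have [dj fj] := Hq j jJ.
  have [ji|ji] := eqVneq j i.
    have [|y yq py] := dj w; first by rewrite inE wW ji wi.
    by exists y => _; split=> //; rewrite -ji.
  case: (boolP (j \in K)) => jK.
    have /set0Pn[w' w'j] : W :&: T_ j != set0 by move: jK; rewrite inE jJ.
    by have [y yq fy] := depends_on_values w'j dj (z j); exists y.
  by exists (q_ j) => _; split=> //; rewrite fj // zp.
pose y := glue J T_ y_ (glue J T_ q_ [ffun=> false]).
have fy e j : j \in J -> j != i -> f_ j (upd y w e) = z j.
  move=> jJ ji; have [_] := Hy j jJ; rewrite (negPf ji) => <-.
  apply: sf => // t tj; rewrite upd_neq ?/y ?(glueE dT _ _ jJ tj) //.
  apply: contraNneq ji => tw; rewrite tw in tj.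
  by rewrite (block_unique dT jJ iJ tj wi).
have fyi e : f_ i (upd y w e) = f_ i (upd (y_ i) w e).
  apply: sf => // t ti; have [->|tw] := eqVneq t w; first by rewrite !updE.
  by rewrite !upd_neq // /y (glueE dT _ _ iJ ti).
exists y.
  move=> t tW; rewrite /y; have [/existsP[j /andP[jJ tj]]|no] :=
      boolP [exists j, (j \in J) && (t \in T_ j)].
    rewrite !(glueE dT _ _ jJ tj); apply: (Hy j jJ).1.
    by rewrite inE (negPf tW).
  rewrite ffunE; case: pickP => // j tj.
  by case/existsP: no; exists j.
have [_] := Hy i iJ; rewrite eqxx => pi.
have mi := reduced_monotone (rf i iJ).
apply: contraNneq (gz : pivotal g i z) => E; apply/eqP.
have up e : g (upd z i e) = f (upd y w e).
  rewrite fE; apply: (gate_agree Jrel) => j jJ; rewrite !ffunE.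
  case: eqP => [->|/eqP ji]; last by rewrite fy.
  by rewrite fyi (monotone_pivotal mi pi).
by rewrite !up.
Qed.

Lemma reduced_relevant T f i : reduced T f -> i \in T <-> relevant f i.
Proof.
move=> rf; split=> [iT|]; last exact: supported_relevant (reduced_supported rf).
have [q /(_ i (set11 i)) [y _ py]] := reduced_depends_on rf (W := [set i])
  ltac:(by rewrite sub1set).
by exists y.
Qed.

End ReadOnce.

(** * Closure of reduced functions under restriction *)

Section Closure.
Variables (R : realType) (l n : nat).
Implicit Types (x y z q : assignment n) (f : assignment n -> bool).
Implicit Types (S T U W V : {set 'I_n}).
Notation reduced := (@reduced R l n).
Notation trivial_or_reduced := (@trivial_or_reduced R l n).

Lemma trivial_or_reducedS U V f : U \subset V ->
  trivial_or_reduced U f -> trivial_or_reduced V f.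
Proof.
move=> UV [?|[T TU rf]]; [by left | right; exists T => //].
exact: subset_trans UV.
Qed.

(** Constant subfunctions are absorbed into the gate, whose active inputs are then those that are
    still relevant; if none is left, [f] is constant. *)
Lemma trivial_or_reduced_gate m (g : boolfun m) (U_ : 'I_m -> {set 'I_n})
    (f_ : 'I_m -> assignment n -> bool) f :
  (m <= l)%N -> threshold_gate R g ->
  (forall i, trivial_or_reduced (U_ i) (f_ i)) ->
  (forall i j, i != j -> [disjoint U_ i & U_ j]) ->
  (forall x, f x = g [ffun i => f_ i x]) ->
  trivial_or_reduced (\bigcup_i U_ i) f.
Proof.
move=> ml tg cf dU fE.
have /exists_choice[k Hk] : forall i : 'I_m, exists k : option bool * {set 'I_n},
    if k.1 is Some b then forall x, f_ i x = b
    else k.2 \subset U_ i /\ reduced k.2 (f_ i).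
  move=> i; case: (cf i) => [[b fb]|[T TU rT]]; first by exists (Some b, set0).
  by exists (None, T).
pose g1 : boolfun m := [ffun z : assignment m => g [ffun i => odflt (z i) (k i).1]].
have fE1 x : f x = g1 [ffun i => f_ i x].
  rewrite fE ffunE; congr (g _); apply/ffunP=> i; rewrite !ffunE.
  by have := Hk i; case: (k i).1 => [b|] //= ->.
pose J := [set i | `[< relevant g1 i >]].
have JP i : i \in J <-> relevant g1 i by rewrite inE; split => /asboolP.
have [J0|J0] := eqVneq J set0.
  left; exists (g1 [ffun=> false]) => x; rewrite fE1.
  by apply: (gate_agree JP) => i; rewrite J0 inE.
have Jk i : i \in J -> (k i).1 = None.
  move=> /JP[z]; rewrite /pivotal !ffunE; case ki: (k i).1 => [b|//].
  case/eqP; congr (g _); apply/ffunP=> j; rewrite !ffunE.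
  by case: eqP => // ->; rewrite ki.
right; exists (\bigcup_(i in J) (k i).2).
  apply/bigcupsP=> i /Jk ki; apply: subset_trans (bigcup_sup i _) => //.
  by have := Hk i; rewrite ki => -[].
apply: (@ReducedGate _ _ _ _ _ m g1 J (fun i => (k i).2) f_) => //.
- exact: threshold_restrict.
- by move=> i /Jk ki; have := Hk i; rewrite ki => -[].
- move=> i j /Jk ki /Jk kj ij; have := Hk i; rewrite ki => -[si _].
  have := Hk j; rewrite kj => -[sj _].
  exact: disjointWl si (disjointWr sj (dU _ _ ij)).
Qed.

Lemma reduced_override T f V p : reduced T f ->
  trivial_or_reduced T (fun y => f (override V p y)).
Proof.
elim=> {T f} [T f i -> fi|T f m g J T_ f_ ml tg Jrel _ rf IH dT -> fE].
  have [iV|iV] := boolP (i \in V).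
    by left; exists (p i) => x; rewrite fi overrideE.
  right; exists [set i] => //; apply: (@ReducedVar _ _ _ _ _ i) => // x.
  by rewrite fi override_off.
(* Inactive inputs, where [f_] is arbitrary, are replaced by the constant 0 with an empty block. *)
clear T; pose f0 i y := (i \in J) && f_ i (override V p y).
rewrite big_mkcond /=; apply: (trivial_or_reduced_gate (f_ := f0) ml tg).
- move=> i; case: (boolP (i \in J)) => iJ; last first.
    by left; exists false => x; rewrite /f0 (negPf iJ).
  case: (IH i iJ) => [[b fb]|[T TT rT]].
    by left; exists b => x; rewrite /f0 iJ fb.
  right; exists T => //; apply: reduced_ext rT => x.
  by rewrite /f0 iJ.
- move=> i j ij; case: (boolP (i \in J)) => iJ; last first.
    by rewrite -setI_eq0 set0I.
  case: (boolP (j \in J)) => jJ; last by rewrite -setI_eq0 setI0.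
  exact: dT.
- move=> x; rewrite fE; apply: (gate_agree Jrel) => i iJ.
  by rewrite !ffunE /f0 iJ.
Qed.

Definition reducible f := trivial_or_reduced setT f.

Lemma reducible_ext f f' : f =1 f' -> reducible f -> reducible f'.
Proof.
move=> e [[b fb]|[T sT rT]]; first by left; exists b => x; rewrite -e.
by right; exists T => //; apply: reduced_ext rT.
Qed.

Lemma reducible_override f V p : reducible f ->
  reducible (fun y => f (override V p y)).
Proof.
move=> [[b fb]|[T _ rT]]; first by left; exists b.
by apply: trivial_or_reducedS (reduced_override V p rT); exact: subsetT.
Qed.

Lemma reducible_monotone f : reducible f -> monotone f.
Proof.
by move=> [[b fb] x y _|[T _ rT]]; [rewrite !fb|exact: reduced_monotone rT].
Qed.

Lemma reducible_reduced T f : reducible f -> T != set0 ->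
  (forall i, i \in T <-> relevant f i) -> reduced T f.
Proof.
move=> [[b fb]|[T' _ rf]] /set0Pn[t tT] Trel.
  by have /Trel[y] := tT; rewrite /pivotal !fb eqxx.
have -> // : T = T'.
apply/setP=> i; apply/idP/idP => [/Trel /(reduced_relevant i rf)|] //.
by move=> /(reduced_relevant i rf) /Trel.
Qed.

(** With the variables outside [W] fixed as in [q], [f] becomes a reducible function to which all of
    [W] is relevant, and [reduced_depends_on] applies to it. The smaller subcube lies inside the
    given one. *)
Lemma depends_on_shrink f W V q : reducible f -> depends_on f W q ->
  V \subset W -> exists2 q', eq_off W q' q & depends_on f V q'.
Proof.
move=> cf dW VW; have [->|/set0Pn[v vV]] := eqVneq V set0.
  by exists q => // w; rewrite inE.
pose f1 y := f (override (~: W) q y).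
have f1E y : eq_off W y q -> f1 y = f y.
  move=> yq; congr f; apply/ffunP=> j; rewrite ffunE inE.
  by case: ifP => // /yq.
have rel1 w : w \in W -> relevant f1 w.
  move=> wW; have [y yq py] := dW w wW; exists y.
  by rewrite /pivotal !f1E //; exact: eq_off_upd.
case: (reducible_override (~: W) q cf) => [[b fb]|[T _ rT]].
  have [y] := rel1 v (subsetP VW v vV).
  by rewrite /pivotal /f1 !fb eqxx.
have VT : V \subset T.
  apply/subsetP=> w wV; apply/(reduced_relevant w rT)/rel1.
  exact: (subsetP VW).
have [q1 dq1] := reduced_depends_on rT VT.
exists (override W q1 q); first exact: override_off.
move=> w wV; have [y yq py] := dq1 w wV.
exists (override W y q).
  move=> j jV; rewrite !ffunE; case: ifP => // _; exact: yq.
have wW := subsetP VW w wV.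
apply: contraNneq (py : pivotal f1 w y) => E; apply/eqP.
have fo e : f1 (upd y w e) = f (upd (override W y q) w e).
  congr f; apply/ffunP=> j; rewrite !ffunE inE.
  have [->|jw] := eqVneq j w; first by rewrite wW.
  by case: (j \in W).
by rewrite !fo.
Qed.

Lemma reduced1 i f : reduced [set i] f -> forall x, f x = x i.
Proof.
move=> rf x; have /(reduced_relevant i rf)[y py] := set11 i.
rewrite -(monotone_pivotal (reduced_monotone rf) py (x i)).
by apply: reduced_supported rf _ _ _ => j; rewrite inE => /eqP ->; rewrite updE.
Qed.

End Closure.

(** * Modules, transversals and localization *)

Section Structure.
Variables (R : realType) (l n : nat).
Implicit Types (x y z q : assignment n) (f : assignment n -> bool).
Implicit Types (S T U W V : {set 'I_n}).
Notation reduced := (@reduced R l n).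

(** Descent into blocks with several variables ends at a gate all of whose active blocks are single
    variables, at most [l] of them; these form [S], and [g] is the subformula at this gate. By the
    last clause [f] sees [S] only through [g]. *)
Lemma reduced_module T f : reduced T f -> (1 < #|T|)%N ->
  exists S (g : assignment n -> bool),
    [/\ S \subset T, (1 < #|S| <= l)%N, supported S g /\ monotone g,
        (exists2 s, s \in S & relevant g s) &
        forall x y, eq_off S x y -> g x = g y -> f x = f y].
Proof.
move=> rf0; elim: (rf0) => {T f rf0}
  [T f i -> fi|T f m g J T_ f_ ml tg Jrel J0 rf IH dT TE fE] T2.
  by rewrite cards1 in T2.
have rT : reduced T f by exact: (@ReducedGate _ _ _ _ _ m g J T_ f_).
have [/existsP[i /andP[iJ i2]]|small] := boolP [exists i in J, 1 < #|T_ i|]%N.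
  have [S [h [ST Sl shmh rh mod]]] := IH i iJ i2.
  exists S, h; split=> //.
    by apply: subset_trans ST _; rewrite TE; exact: bigcup_sup.
  move=> x y xy hxy; rewrite !fE; apply: (gate_agree Jrel) => j jJ; rewrite !ffunE.
  have [->|ji] := eqVneq j i; first exact: mod.
  apply: (reduced_supported (rf j jJ)) => t tj; apply: xy.
  apply: contra ji => /(subsetP ST) ti.
  by rewrite (block_unique dT jJ iJ tj ti).
have [t tT] := reduced_nonempty rT.
exists T, f; split=> //.
- rewrite T2 /= TE; apply: leq_trans ml; rewrite -[m in (_ <= m)%N]card_ord.
  apply: leq_trans (max_card (mem J)); rewrite -sum1_card.
  apply: leq_trans (_ : \sum_(i in J) #|T_ i| <= _)%N.
    elim/big_ind2: _ => [|A a B b Aa Bb|//]; first by rewrite cards0.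
    apply: leq_trans (leq_add Aa Bb).
    by rewrite cardsU leq_subr.
  apply: leq_sum => i iJ; rewrite leqNgt; apply: contra small => i2.
  by apply/existsP; exists i; rewrite iJ.
- by split; [exact: reduced_supported rT|exact: reduced_monotone rT].
- by exists t => //; apply/(reduced_relevant t rT).
Qed.

(* [W] consists of one variable for each sibling of the subformulas containing
   [t] at the first gate where [t] meets other variables. *)
Lemma reduced_transversal T f t : reduced T f -> t \in T ->
  exists W, [/\ W \subset T :\ t, (#|W| <= l)%N, T :\ t != set0 -> W != set0 &
    forall V q c, W \subset V -> depends_on (fun y => f (upd y t c)) V q ->
      exists2 y, eq_off V y q & pivotal f t y].
Proof.
elim=> {T f} [T f i -> fi|T f m g J T_ f_ ml tg Jrel J0 rf IH dT TE fE] tT.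
  exists set0; split; rewrite ?sub0set ?cards0 //.
    by move: tT; rewrite inE => /eqP ->; rewrite setDv eqxx.
  move=> V q c _ _; exists q => //.
  by move: tT; rewrite inE /pivotal !fi => /eqP ->; rewrite !updE.
have sf i : i \in J -> supported (T_ i) (f_ i).
  by move=> iJ; apply: reduced_supported (rf i iJ).
move: tT; rewrite TE => /bigcupP[i iJ ti].
have Tt j : j \in J -> j != i -> t \notin T_ j.
  by move=> jJ; apply: contra => tj; rewrite (block_unique dT jJ iJ tj ti).
have fupd j y e : j \in J -> j != i -> f_ j (upd y t e) = f_ j y.
  move=> jJ ji; apply: sf => // s sj; rewrite upd_neq //.
  by apply: contraNneq (Tt j jJ ji) => <-.
pose fc c := fun y => f (upd y t c).
pose fc_ c j := fun y => f_ j (upd y t c).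
have fcE c y : fc c y = g [ffun j => fc_ c j y] by rewrite /fc fE.
have sfc c j : j \in J -> supported (T_ j) (fc_ c j).
  move=> jJ x y xy; apply: sf => // s sj; rewrite !ffunE.
  by case: eqP => // _; exact: xy.
(* If [t] is alone in its block, one variable from each sibling block allows the siblings to be
   driven to values [z j] at which [g] reads input [i]. *)
have [Ti1|Ti1] := eqVneq (T_ i :\ t) set0.
  have Tit : T_ i = [set t] by rewrite -(setD1K ti) Ti1 setU0.
  have /exists_choice[s_ Hs] : forall j : 'I_m, exists s, j \in J -> s \in T_ j.
    move=> j; case: (boolP (j \in J)) => jJ; last by exists t.
    by have [s sj] := reduced_nonempty (rf j jJ); exists s.
  exists [set s_ j | j in J :\ i]; split.
  - apply/subsetP=> s /imsetP[j]; rewrite !inE => /andP[ji jJ] ->.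
    apply/andP; split; last by apply/bigcupP; exists j => //; exact: Hs.
    by apply: contraNneq (Tt j jJ ji) => <-; exact: Hs.
  - apply: leq_trans (leq_imset_card _ _) _; apply: leq_trans ml.
    by rewrite -[m in (_ <= m)%N]card_ord max_card.
  - case/set0Pn=> s; rewrite !inE => /andP[st /bigcupP[j jJ sj]].
    apply/set0Pn; exists (s_ j); apply: imset_f; rewrite !inE jJ andbT.
    by apply: contraNneq st => ji; rewrite ji Tit inE in sj.
  move=> V q c WV dV; have [z gz] := (Jrel i).1 iJ.
  have /exists_choice[y_ Hy] : forall j : 'I_m, exists y, j \in J -> j != i ->
      eq_off V y q /\ f_ j y = z j.
    move=> j; have [/andP[jJ ji]|no] := boolP ((j \in J) && (j != i)); last first.
      by exists q => jJ ji; rewrite jJ ji in no.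
    have dj := depends_on_block Jrel dT (sfc c) (fcE c) jJ dV.
    have sV : s_ j \in V :&: T_ j.
      rewrite inE Hs // andbT; apply: (subsetP WV); apply: imset_f.
      by rewrite !inE ji.
    have [y yq fy] := depends_on_values sV dj (z j).
    exists y => _ _; split; last by rewrite -fy /fc_ fupd.
    by apply: eq_offS yq; exact: subsetIl.
  pose y := glue (J :\ i) T_ y_ q.
  have dT' j k : j \in J :\ i -> k \in J :\ i -> j != k -> [disjoint T_ j & T_ k].
    by rewrite !inE => /andP[_ jJ] /andP[_ kJ]; exact: dT.
  exists y.
    by apply: glue_off => j; rewrite !inE => /andP[ji jJ]; apply: (Hy j jJ ji).1.
  apply: contraNneq (gz : pivotal g i z) => E; apply/eqP.
  have up e : g (upd z i e) = f (upd y t e).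
    rewrite fE; apply: (gate_agree Jrel) => j jJ; rewrite !ffunE.
    case: eqP => [->|/eqP ji].
      have := rf i iJ; rewrite Tit => /reduced1 ->.
      by rewrite updE.
    have jJi : j \in J :\ i by rewrite !inE ji.
    rewrite fupd // -(Hy j jJ ji).2; apply: sf => // s sj.
    by rewrite /y (glueE dT' _ _ jJi sj).
  by rewrite !up.
have [W [WT Wl W0 HW]] := IH i iJ ti.
have /set0Pn[w wW] := W0 Ti1.
have wi : w \in T_ i by have := subsetP WT w wW; rewrite inE => /andP[].
have wt : w != t by have := subsetP WT w wW; rewrite !inE => /andP[].
exists W; split=> // [|_|V q c WV dV].
- by apply: subset_trans WT _; apply: setSD; exact: bigcup_sup.
- exact: W0.
have di := depends_on_block Jrel dT (sfc c) (fcE c) iJ dV.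
have WVi : W \subset V :&: T_ i.
  by rewrite subsetI WV /=; apply: subset_trans WT _; exact: subsetDl.
have [yi yiq pyi] := HW _ _ _ WVi di.
(* Off the block of [t] the point copies [y'], where [w] is pivotal: as [w] lies in the same block
   as [t], the gate passes on a change of input [i] there. *)
have [y' yq' py'] := dV w (subsetP WV w wW).
have eqj j y e : j \in J -> j != i -> (forall s, s \in T_ j -> y s = y' s) ->
    f_ j (upd y t e) = f_ j y'.
  by move=> jJ ji e'; rewrite fupd //; apply: sf.
exists (override (T_ i) yi y').
  move=> s sV; rewrite ffunE; case: ifP => si; last exact: yq'.
  by apply: yiq; rewrite inE (negPf sV).
have mi := reduced_monotone (rf i iJ).
apply: contraNneq (py' : pivotal (fc c) w y') => E; apply/eqP.
pose z : assignment m := [ffun j => f_ j y'].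
have Eg b : f (upd (override (T_ i) yi y') t b) = g (upd z i b).
  rewrite fE; apply: (gate_agree Jrel) => j jJ; rewrite !ffunE.
  case: eqP => [->|/eqP ji].
    rewrite -[RHS](monotone_pivotal mi pyi b); apply: sf => // s si.
    have [->|st] := eqVneq s t; first by rewrite !updE.
    by rewrite !upd_neq // overrideE.
  apply: eqj => // s sj; rewrite override_off //.
  by apply: contra ji => si; rewrite (block_unique dT jJ iJ sj si).
have Ew e : fc c (upd y' w e) = g (upd z i (f_ i (upd (upd y' w e) t c))).
  rewrite fcE; apply: (gate_agree Jrel) => j jJ; rewrite !ffunE.
  case: eqP => [->//|/eqP ji].
  rewrite /fc_ fupd //; apply: sf => // s sj; rewrite upd_neq //.
  apply: contraNneq ji => sw; rewrite sw in sj.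
  by rewrite (block_unique dT jJ iJ sj wi).
rewrite !Ew -!Eg.
by case: (f_ i _); case: (f_ i _).
Qed.

End Structure.

(** * Controlling a set of variables inside a subcube *)

Section Localize.
Variables (R : realType) (l n : nat).
Hypothesis l_gt0 : (0 < l)%N.
Implicit Types (x y z q a b : assignment n) (f : assignment n -> bool).
Implicit Types (S T U W V : {set 'I_n}).
Notation reduced := (@reduced R l n).

Lemma override0 a y : override set0 a y = y.
Proof. by apply/ffunP=> j; rewrite ffunE inE. Qed.

(* For [S] empty any single variable will do; otherwise [W] adds to [S] one
   variable for each sibling along the gates where [S] branches, and for the
   siblings that make a path of unary gates constant at [b]. The size bound
   [l * (2 * #|S| - 1)] is written without subtraction. *)
Lemma reduced_localize T f S b : reduced T f -> S \subset T ->
  exists W, [/\ S \subset W, W \subset T,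
    (#|W| + l <= 2 * l * #|S| + (if S == set0 then l.+1 else 0))%N &
    forall q, depends_on f W q -> exists2 y, eq_off W y q &
      forall a, f (override S a y) = f (override S a b)].
Proof.
move=> rf0; elim: (rf0) S => {T f rf0}
  [T f i -> fi|T f m g J T_ f_ ml tg Jrel J0 rf IH dT TE fE] S ST.
  exists [set i]; split=> //.
    rewrite cards1; have [->|/set0Pn[j jS]] := eqVneq S set0.
      by rewrite cards0; lia.
    by have : (0 < #|S|)%N; [apply/card_gt0P; exists j | nia].
  move=> q _; exists (override [set i] b q); first exact: override_off.
  by move=> a; rewrite !fi !ffunE inE eqxx.
have rT : reduced T f by exact: (@ReducedGate _ _ _ _ _ m g J T_ f_).
have [S0|S0] := eqVneq S set0.
  have [t tT] := reduced_nonempty rT; exists [set t]; split.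
  - by rewrite S0 sub0set.
  - by rewrite sub1set.
  - by rewrite S0 cards1 cards0; lia.
  move=> q dq; have [y yq fy] := depends_on_values (set11 t) dq (f b).
  by exists y => // a; rewrite S0 !override0.
have sf i : i \in J -> supported (T_ i) (f_ i).
  by move=> iJ; apply: reduced_supported (rf i iJ).
have dep q W i := @depends_on_block n m g J T_ f_ f W q i Jrel dT sf fE.
pose K := [set i in J | S :&: T_ i != set0].
have KJ : K \subset J by apply/subsetP=> i; rewrite inE => /andP[].
have Sin s : s \in S -> exists2 i, i \in K & s \in T_ i.
  move=> sS; have := subsetP ST s sS; rewrite TE => /bigcupP[i iJ si].
  by exists i => //; rewrite inE iJ; apply/set0Pn; exists s; rewrite inE sS.
have TJ i : i \in J -> T_ i \subset T.
  by move=> iJ; rewrite TE; exact: bigcup_sup.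
have S1 : (0 < #|S|)%N by rewrite card_gt0.
have lJ : (#|J| <= l)%N.
  by apply: leq_trans ml; rewrite -[m in (_ <= m)%N]card_ord max_card.
have /exists_choice[s_ Hs] : forall j : 'I_m, exists s, j \in J -> s \in T_ j.
  move=> j; have [/set0Pn[s0 _]] := (S0, tt).
  case: (boolP (j \in J)) => jJ; last by exists s0.
  by have [s sj] := reduced_nonempty (rf j jJ); exists s.
have [/cards1P[i Ki]|K1] := boolP (#|K| == 1%N).
  have iK : i \in K by rewrite Ki inE.
  have iJ := subsetP KJ i iK.
  have Si : S \subset T_ i.
    apply/subsetP=> s /Sin[j]; rewrite Ki inE => /eqP -> //.
  (* [S] lies in block [i] alone. [u] is the gate as a function of this block, the siblings being as
     at [b]; by monotonicity it is the identity or constant. *)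
  pose u e := g [ffun j => if j == i then e else f_ j b].
  have fu y e : (forall j, j \in J -> j != i -> f_ j y = f_ j b) ->
      f_ i y = e -> f y = u e.
    move=> yb <-; rewrite fE; apply: (gate_agree Jrel) => j jJ; rewrite !ffunE.
    by case: eqP => [->|/eqP ji] //; exact: yb.
  have off a j : j \in J -> j != i -> f_ j (override S a b) = f_ j b.
    move=> jJ ji; apply: sf => // s sj; rewrite override_off //.
    apply: contra ji => /(subsetP Si) si.
    by rewrite (block_unique dT jJ iJ sj si).
  have [ut|uc] := boolP (u false != u true).
    have [W [SW WT Wc HW]] := IH i iJ S Si.
    rewrite (negPf S0) in Wc.
    exists W; split=> //; first exact: subset_trans WT (TJ i iJ).
    move=> q dW; have := dep q W i iJ dW; rewrite (setIidPl WT) => dWi.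
    have [y yq fy] := HW q dWi; exists y => // a.
    have /set0Pn[s sS] := S0; have sW := subsetP SW s sS.
    have [y' yq' py'] := dW s sW.
    (* [v] is the analogue of [u] with the siblings as at [q]. It is the identity because a variable
       of [S] is pivotal in the subcube, so the induction hypothesis for block [i] is enough. *)
    pose v e := g [ffun j => if j == i then e else f_ j q].
    have fv z : eq_off W z q -> f z = v (f_ i z).
      move=> zq; rewrite fE; apply: (gate_agree Jrel) => j jJ; rewrite !ffunE.
      case: eqP => [->|/eqP ji] //; apply: sf => // r rj; apply: zq.
      apply: contra ji => /(subsetP WT) ri.
      by rewrite (block_unique dT jJ iJ rj ri).
    have mono w : (w = u) \/ (w = v) -> w false -> w true.
      have mg := threshold_monotone tg.
      by case=> ->; apply: mg => j; rewrite !ffunE; case: eqP.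
    have uid e : u e = e.
      by apply: monotone_bool_id => //; apply: mono; left.
    have vt : v false != v true.
      have fv' e : f (upd y' s e) = v (f_ i (upd y' s e)).
        by apply: fv; exact: eq_off_upd.
      move: py'; rewrite /pivotal !fv'.
      by case: (f_ i _); case: (f_ i _); rewrite ?eqxx // eq_sym.
    have vid e : v e = e.
            by apply: monotone_bool_id => //; apply: mono; right.
    rewrite fv ?vid; last exact: eq_off_override SW yq.
    by rewrite fy (fu _ _ (off a) erefl) uid.
  (* If [u] is constant, one variable per sibling is used to give the siblings their values at [b];
     then [S] has no influence. *)
  exists (S :|: [set s_ j | j in J :\ i]); split.
  - exact: subsetUl.
  - rewrite subUset ST; apply/subsetP=> s /imsetP[j].
    rewrite !inE => /andP[ji jJ] ->.
    by apply: (subsetP (TJ j jJ)); exact: Hs.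
  - have c1 : (#|[set s_ j | j in J :\ i]| <= #|J :\ i|)%N.
      exact: leq_imset_card.
    have := cardsD1 i J; rewrite iJ => cJ.
    have := leq_card_setU S [set s_ j | j in J :\ i].
    by move=> [c2 _]; rewrite addn0; nia.
  move=> q dW.
  have /exists_choice[y_ Hy] : forall j : 'I_m, exists y, j \in J :\ i ->
      eq_off (S :|: [set s_ j | j in J :\ i]) y q /\ f_ j y = f_ j b.
    move=> j; case: (boolP (j \in J :\ i)) => jJi; last by exists q.
    have jJ : j \in J by move: jJi; rewrite inE => /andP[].
    have sW : s_ j \in (S :|: [set s_ j | j in J :\ i]) :&: T_ j.
      rewrite inE [_ \in T_ j]Hs // andbT inE; apply/orP; right.
      exact: imset_f.
    have [y yq fy] := depends_on_values sW (dep q _ j jJ dW) (f_ j b).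
    by exists y => _; split=> //; apply: eq_offS yq; exact: subsetIl.
  have dT' j k : j \in J :\ i -> k \in J :\ i -> j != k -> [disjoint T_ j & T_ k].
    by rewrite !inE => /andP[_ jJ] /andP[_ kJ]; exact: dT.
  exists (glue (J :\ i) T_ y_ q).
    by apply: glue_off => j /Hy[].
  move=> a; set y := glue _ _ _ _.
  have offy j : j \in J -> j != i -> f_ j (override S a y) = f_ j b.
    move=> jJ ji; have jJi : j \in J :\ i by rewrite !inE ji.
    rewrite -(Hy j jJi).2; apply: sf => // s sj; rewrite override_off.
      by rewrite /y (glueE dT' _ _ jJi sj).
    apply: contra ji => /(subsetP Si) si.
    by rewrite (block_unique dT jJ iJ sj si).
  rewrite (fu _ _ offy erefl) (fu _ _ (off a) erefl).
  by move: uc; rewrite negbK; case: (f_ i _); case: (f_ i _) => // /eqP.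
have K0 : (0 < #|K|)%N.
  have /set0Pn[s /Sin[i iK _]] := S0.
  by apply/card_gt0P; exists i.
have /exists_choice[W_ HW] : forall i : 'I_m, exists W, i \in J ->
  [/\ S :&: T_ i \subset W, W \subset T_ i,
    (#|W| + l <= 2 * l * #|S :&: T_ i| +
      (if S :&: T_ i == set0 then l.+1 else 0))%N &
    forall q, depends_on (f_ i) W q -> exists2 y, eq_off W y q &
      forall a, f_ i (override (S :&: T_ i) a y) =
                f_ i (override (S :&: T_ i) a b)].
  move=> i; case: (boolP (i \in J)) => iJ; last by exists set0.
  by have [W ?] := IH i iJ _ (subsetIr S (T_ i)); exists W.
pose W := \bigcup_(i in J) W_ i.
have WTi i : i \in J -> W :&: T_ i = W_ i.
  move=> iJ; have [_ Wi _ _] := HW i iJ.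
  apply/setP=> s; rewrite inE; apply/andP/idP => [[/bigcupP[j jJ sj] si]|sW].
    have [_ Wj _ _] := HW j jJ.
    by rewrite (block_unique dT iJ jJ si (subsetP Wj s sj)).
  by split; [apply/bigcupP; exists i | exact: (subsetP Wi)].
exists W; split.
- apply/subsetP=> s sS; have [i iK si] := Sin s sS.
  have iJ := subsetP KJ i iK; have [sW _ _ _] := HW i iJ.
  apply/bigcupP; exists i => //; apply: (subsetP sW).
  by rewrite inE sS.
- apply/bigcupsP=> i iJ; have [_ Wi _ _] := HW i iJ.
  exact: subset_trans Wi (TJ i iJ).
- have cW : (#|W| <= \sum_(i in J) #|W_ i|)%N.
    rewrite /W; elim/big_ind2: _ => [|A c B d Ac Bd|//]; first by rewrite cards0.
    by apply: leq_trans (leq_add Ac Bd); rewrite cardsU leq_subr.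
  have cS : (\sum_(i in J) #|S :&: T_ i| = #|S|)%N.
    have cI (A B : {set 'I_n}) :
        (#|A :&: B| = \sum_(s in A) (if s \in B then 1 else 0))%N.
      rewrite -sum1_card -big_mkcondr /=.
      by apply: eq_bigl => s; rewrite inE.
    rewrite -[RHS]sum1_card (eq_bigr _ (fun i _ => cI S (T_ i))).
    rewrite exchange_big /=; apply: eq_bigr => s /Sin[i iK si].
    have iJ := subsetP KJ i iK.
    rewrite (bigD1 i) //= si big1 // => j /andP[jJ ji]; case: ifP => // sj.
    by rewrite (block_unique dT jJ iJ sj si) eqxx in ji.
  have cK : (\sum_(i in J) (if S :&: T_ i == set0 then l.+1 else 0) =
             l.+1 * (#|J| - #|K|))%N.
    rewrite -big_mkcondr /= sum_nat_const mulnC -cardsDS //; congr (_ * _)%N.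
    apply: eq_card => i; rewrite !inE unfold_in.
    by case: (i \in J); rewrite ?negbK ?andbT ?andbF.
  have : (\sum_(i in J) (#|W_ i| + l) <= \sum_(i in J) (2 * l * #|S :&: T_ i| +
      (if S :&: T_ i == set0 then l.+1 else 0)))%N.
    by apply: leq_sum => i iJ; have [] := HW i iJ.
  rewrite !big_split /= -big_distrr /= cS cK sum_nat_const addn0.
  (* Each active block outside [K] costs one variable, and there are at most [l] of them. The blocks
     of [K] save [l] each, and two such savings pay for this and for the [l] on the left. *)
  have K2 : (1 < #|K|)%N by lia.
  have Kl : (2 * l <= #|K| * l)%N by rewrite leq_mul2r K2 orbT.
  have KlJ := subset_leq_card KJ.
  rewrite -{1}(subnKC KlJ) mulnDl [(l.+1 * _)%N]mulSn [(l * (_ - _))%N]mulnC => le.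
  move: cW lJ le Kl KlJ.
  move: (\sum_(i in J) _)%N ((#|J| - #|K|) * l)%N (#|K| * l)%N (2 * l * #|S|)%N.
  move: #|W| #|J| #|K| => *; lia.
move=> q dW.
have /exists_choice[y_ Hy] : forall i : 'I_m, exists y, i \in J ->
    eq_off W y q /\ forall a, f_ i (override (S :&: T_ i) a y) =
                              f_ i (override (S :&: T_ i) a b).
  move=> i; case: (boolP (i \in J)) => iJ; last by exists q.
  have [_ _ _ H] := HW i iJ.
  have := dep q W i iJ dW; rewrite WTi // => /H[y yq fy].
  by exists y => _; split=> //; apply: eq_offS yq; exact: bigcup_sup.
exists (glue J T_ y_ q); first by apply: glue_off => i /Hy[].
move=> a; rewrite !fE; apply: (gate_agree Jrel) => i iJ; rewrite !ffunE.
rewrite (sf i iJ _ (override (S :&: T_ i) a (y_ i))); last first.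
  move=> s si; have [sS|sS] := boolP (s \in S).
    by rewrite !overrideE // inE sS.
  by rewrite !override_off ?inE ?(negPf sS) // (glueE dT _ _ iJ si).
rewrite (Hy i iJ).2; apply: sf => // s si.
by rewrite !ffunE inE si andbT.
Qed.

End Localize.

(** * Identity of read-once functions *)

Section Identity.
Variables (R : realType) (l n : nat).
Hypothesis l_gt0 : (0 < l)%N.
Implicit Types (x y z q a b : assignment n) (f : assignment n -> bool).
Implicit Types (S T U W V : {set 'I_n}).
Notation reduced := (@reduced R l n).
Notation reducible := (@reducible R l n).

(* Collapsing a module [S] with value [g] to its variable [s]: the other
   variables of [S] are frozen as in [r], where [g] reads [s]. *)
Section Collapse.
Variables (S : {set 'I_n}) (g : assignment n -> bool) (s : 'I_n)
  (r : assignment n) (f : assignment n -> bool).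
Hypotheses (sS : s \in S) (sg : supported S g)
  (gr : forall e, g (upd r s e) = e)
  (mod : forall x y, eq_off S x y -> g x = g y -> f x = f y).

Let fr y := f (override (S :\ s) r y).

Lemma collapse_value y : g (override (S :\ s) r y) = y s.
Proof.
rewrite -[RHS]gr; apply: sg => j jS; rewrite !ffunE !inE jS andbT.
by case: eqP => [->|].
Qed.

Lemma collapse_eq y : f y = fr (upd y s (g y)).
Proof.
apply: mod; last by rewrite collapse_value updE.
move=> j jS; rewrite override_off ?inE ?(negPf jS) ?andbF //.
by rewrite upd_neq //; apply: contraNneq jS => ->.
Qed.

(** A point [y] that is pivotal for [f] yields the point [upd y s (g y)] that is pivotal for
    [fr]. *)
Lemma collapse_relevant T : S \subset T -> (forall i, i \in T <-> relevant f i) ->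
  forall i, i \in T :\: (S :\ s) <-> relevant fr i.
Proof.
move=> ST Trel i; split; last first.
  move=> ri; have [y py] := ri; rewrite !inE.
  have -> /= : ~~ ((i != s) && (i \in S)).
    apply: contraTN isT => iS; move: py; rewrite /pivotal /fr.
    suff -> : override (S :\ s) r (upd y i false) =
              override (S :\ s) r (upd y i true) by rewrite eqxx.
    apply/ffunP=> j; rewrite !ffunE !inE; case: ifP => // jS.
    by case: eqP => // ji; rewrite ji iS in jS.
  have [//|iT] := boolP (i \in T); move: py; rewrite /pivotal /fr.
  rewrite (@relevant_supported _ f _ (override (S :\ s) r (upd y i true))) ?eqxx //.
  move=> j /Trel jT; rewrite !ffunE; case: ifP => // _.
  by case: eqP => // ji; rewrite -ji jT in iT.
rewrite !inE => /andP[iS /Trel[y py]].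
have [is_|ns] := eqVneq i s.
  exists (upd y s (g y)); move: py; rewrite is_ /pivotal !(collapse_eq (upd _ _ _)).
  rewrite !upd_upd; case: (g _); case: (g _); rewrite ?eqxx //.
  by rewrite eq_sym.
rewrite ns /= in iS.
exists (upd y s (g y)); move: py; rewrite /pivotal !(collapse_eq (upd _ _ _)).
have gE e : g (upd y i e) = g y.
  by apply: sg => j jS; rewrite upd_neq //; apply: contraNneq iS => <-.
by rewrite !gE ![upd (upd y i _) s _]upd_comm.
Qed.

(** [W] meets [S] at most in [s]. If it contains [s], then [g] reads [s] on the subcube and [y']
    itself will do; otherwise [g] is constant there and only the old value of [s] must be
    restored. *)
Lemma collapse_cube T W q y' : monotone g -> W \subset T :\: (S :\ s) ->
  depends_on f W q -> eq_off W y' (upd q s (g q)) ->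
  exists2 y, eq_off W y q & upd y s (g y) = y'.
Proof.
move=> mg WT dW y'q.
have WS j : j \in S -> j != s -> j \notin W.
  move=> jS js; apply/negP => /(subsetP WT); by rewrite !inE jS js.
have [sW|sW] := boolP (s \in W).
  exists y'.
    by move=> j jW; rewrite y'q // upd_neq //; apply: contraNneq jW => ->.
  apply: upd_idem; have [y0 y0q py0] := dW s sW.
  have pg : pivotal g s y0.
    apply: contraNneq (py0 : pivotal f s y0) => E; apply/eqP/mod => // j jS.
    by rewrite !upd_neq //; apply: contraNneq jS => ->.
  rewrite -[LHS](monotone_pivotal mg pg); apply: sg => j jS.
  have [->|js] := eqVneq j s; first by rewrite updE.
  by rewrite upd_neq // y0q ?WS // y'q ?WS // upd_neq.
exists (upd y' s (q s)).
  move=> j jW; have [->|js] := eqVneq j s; first by rewrite updE.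
  by rewrite upd_neq // y'q // upd_neq.
have -> : g (upd y' s (q s)) = g q.
  apply: sg => j jS; have [->|js] := eqVneq j s; first by rewrite updE.
  by rewrite upd_neq // y'q ?WS // upd_neq.
by rewrite upd_upd upd_idem // y'q // updE.
Qed.

End Collapse.

(** Induction on [#|T|], collapsing a module of [f] in both functions. The bound [2 * l * l] is what
    localizing a module of at most [l] variables requires. *)
Theorem reduced_identity T f f' : reduced T f -> reduced T f' ->
  (forall W, W \subset T -> (#|W| <= 2 * l * l)%N -> exists2 q,
     depends_on f W q & forall y, eq_off W y q -> f y = f' y) ->
  f =1 f'.
Proof.
have [k] := ubnP #|T|; elim: k T f f' => // k IH T f f' Tk rf rf' agree.
have [T1|] := leqP #|T| 1.
  have [t tT] := reduced_nonempty rf.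
  have TE : T = [set t].
    by apply/esym/eqP; rewrite eqEcard sub1set tT cards1.
  by rewrite TE in rf rf' => x; rewrite (reduced1 rf) (reduced1 rf').
move=> /(reduced_module rf)[S [g [ST /andP[S2 Sl] [sg mg] [s sS [r pr]] modf]]].
have gr := monotone_pivotal mg pr.
(* [S] is a module of [f'] with the same [g]: localization gives a subcube on which [f'] varies with
   [S] as it does around [x], and there [f'] agrees with [f]. *)
have modf' x y : eq_off S x y -> g x = g y -> f' x = f' y.
  move=> xy gxy; have [W [SW WT Wl HW]] := reduced_localize l_gt0 x rf' ST.
  have S0 : S != set0 by rewrite -card_gt0; exact: ltnW.
  have Wk : (#|W| <= 2 * l * l)%N.
    rewrite (negPf S0) addn0 in Wl.
    by apply: leq_trans (leq_addr l _) (leq_trans Wl _); rewrite leq_mul2l Sl orbT.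
  have [q dW ff'] := agree W WT Wk.
  have [z zq fz] := HW q (depends_on_agree ff' dW).
  have ex a : eq_off W (override S a z) q by exact: eq_off_override.
  rewrite -{1}(override_id S x) -fz -ff' //.
  have -> : y = override S y x.
    by apply/ffunP=> j; rewrite ffunE; case: ifP => // /negbT /xy ->.
  rewrite -fz -ff' //; apply: modf.
    by move=> j jS; rewrite !override_off.
  rewrite (sg _ x); last by move=> j jS; rewrite overrideE.
  by rewrite gxy; apply: sg => j jS; rewrite !overrideE.
have cE := collapse_eq sS sg gr modf.
have cE' := collapse_eq sS sg gr modf'.
set fr := fun y => f (override (S :\ s) r y).
set fr' := fun y => f' (override (S :\ s) r y).
suff e : fr =1 fr' by move=> x; rewrite cE cE'; exact: e.
have T'0 : T :\: (S :\ s) != set0.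
  by apply/set0Pn; exists s; rewrite !inE eqxx (subsetP ST).
have red h : reduced T h -> (forall x y, eq_off S x y -> g x = g y -> h x = h y) ->
    reduced (T :\: (S :\ s)) (fun y => h (override (S :\ s) r y)).
  move=> rh modh; apply: reducible_reduced => //.
    by apply: reducible_override; right; exists T => //; exact: subsetT.
  by apply: (collapse_relevant sS sg gr modh ST) => i; exact: reduced_relevant rh.
apply: (IH (T :\: (S :\ s))) => //.
- apply: leq_trans (_ : #|T| <= _)%N; last by rewrite -ltnS.
  have sT := subsetP ST s sS.
  rewrite ltnNge; apply/negP => le.
  have := cardsDS (subset_trans (subD1set S s) ST).
  have := cardsD1 s S; rewrite sS => cS; move: le; rewrite -ltnS => le cD.
  have := subset_leq_card (subset_trans (subD1set S s) ST); lia.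
- exact: red.
- exact: red.
move=> W WT' Wk; have WT : W \subset T.
  by apply: subset_trans WT' _; exact: subsetDl.
have [q dW ff'] := agree W WT Wk.
(* Agreement carries over since each point of the collapsed subcube comes from one of the old
   subcube. *)
exists (upd q s (g q)); last first.
  move=> y' /(collapse_cube sS sg modf mg WT' dW)[y yq <-].
  by rewrite -[LHS]cE -[RHS]cE' ff'.
move=> w wW; have [y yq py] := dW w wW.
have [ws|ws] := eqVneq w s.
  exists (upd y s (g q)).
    move=> j jW; rewrite !ffunE; case: eqP => // _; exact: yq.
  move: py; rewrite ws /pivotal !(cE (upd _ _ _)) !upd_upd -/(fr _) -/(fr _).
  by case: (g _); case: (g _); rewrite ?eqxx // eq_sym.
have wS : w \notin S by have := subsetP WT' w wW; rewrite !inE ws; case/andP.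
have gE e : g (upd y w e) = g y.
  by apply: sg => j jS; rewrite upd_neq //; apply: contraNneq wS => <-.
exists (upd y s (if s \in W then g y else g q)).
  move=> j jW; rewrite !ffunE; case: eqP => [js|_]; last exact: yq.
  by rewrite js in jW; rewrite (negPf jW).
suff <- : g y = (if s \in W then g y else g q).
  move: py; rewrite /pivotal !(cE (upd _ _ _)) !gE.
  by rewrite ![upd (upd y w _) s _]upd_comm.
case: ifP => // sW; apply: sg => j jS; apply: yq.
apply/negP => jW; have := subsetP WT' j jW; rewrite !inE jS andbT.
by case: (j =P s) => // js; rewrite js sW in jW.
Qed.

End Identity.

(** * Learning one more free variable *)

Section Extension.
Variables (R : realType) (l n : nat).
Hypothesis l_gt0 : (0 < l)%N.
Implicit Types (x y z q : assignment n) (f h : assignment n -> bool).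
Implicit Types (S T U W V : {set 'I_n}).
Notation reduced := (@reduced R l n).
Notation reducible := (@reducible R l n).

Section Extension1.
Variables (T : {set 'I_n}) (h : assignment n -> bool) (t : 'I_n) (c : bool).
Hypotheses (tT : t \notin T) (Trel : forall i, i \in T <-> relevant h i).
Variable q_ : {set 'I_n} -> assignment n.
Hypothesis q_dep : forall W, W \subset T -> depends_on h W (q_ W).

Definition extends f := [/\ reducible f, supported (t |: T) f &
  forall y, f (upd y t c) = h y].

Lemma extends_upd f y i e : extends f -> i \in T ->
  h (upd y i e) = f (upd (upd y t c) i e).
Proof.
move=> [_ _ fh] iT; rewrite -fh upd_comm //.
by apply: contraNneq tT => <-.
Qed.

Lemma extends_relevant f i : extends f -> relevant f t ->
  i \in t |: T <-> relevant f i.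
Proof.
move=> ef rt; split; last by case: ef => _ sf _; exact: supported_relevant.
rewrite in_setU1 => /orP[/eqP -> //|iT].
have /Trel[y py] := iT; exists (upd y t c).
by move: py; rewrite /pivotal !(extends_upd _ _ ef).
Qed.

Lemma extends_reduced f : extends f -> relevant f t -> reduced (t |: T) f.
Proof.
move=> ef rt; have [cf _ _] := ef; apply: reducible_reduced cf _ _.
  by apply/set0Pn; exists t; rewrite setU11.
by move=> i; exact: extends_relevant.
Qed.

Lemma extends_irrelevant f : extends f -> ~ relevant f t -> f =1 h.
Proof.
move=> [_ _ fh] nr y; rewrite -fh; apply/eqP/negPn/negP => ne; apply: nr.
exists y; apply: (@pivotal_neq _ _ _ _ (y t) c).
by rewrite upd_same.
Qed.

(** The points concerned depend only on the known [h], through [q_], so they can all be queried. In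
    the size bound, [2 * l * l] serves the identity theorem and [l] a transversal of [t]. *)
Definition agree_nearby f f' := forall W y, W \subset T ->
  (#|W| <= 2 * l * l + l)%N -> eq_off (t |: W) y (q_ W) -> f y = f' y.

(** [W] is a transversal of [t]. With [t] fixed at [c], [f] is [h], which depends on all of [V]
    around [q_ V]; this forces [t] to be pivotal in that subcube. *)
Lemma extension_pivot f : extends f -> relevant f t ->
  exists W, [/\ W \subset T, (#|W| <= l)%N &
    forall V, V \subset T -> W \subset V ->
      exists2 y, eq_off V y (q_ V) & pivotal f t y].
Proof.
move=> ef rt; have rf := extends_reduced ef rt.
have [W [WT Wl _ HW]] := reduced_transversal rf (setU11 t T).
exists W; split=> //.
  by move: WT; rewrite setU1K.
move=> V VT WV; apply: (HW V (q_ V) c WV).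
by apply: eq_depends_on (q_dep VT) => y; have [_ _ ->] := ef.
Qed.

Lemma agree_nearby_relevant f f' : extends f -> agree_nearby f f' ->
  relevant f t -> relevant f' t.
Proof.
move=> ef ff' rt; have [W [WT Wl HW]] := extension_pivot ef rt.
have [y yq py] := HW W WT (subxx _); exists y; move: py.
have e b : f (upd y t b) = f' (upd y t b).
  apply: (ff' W) => //; first by lia.
  by apply: eq_off_upd; rewrite ?setU11 //; apply: eq_offS yq; exact: subsetUr.
by rewrite /pivotal !e.
Qed.

Theorem extension_identity f f' : extends f -> extends f' ->
  agree_nearby f f' -> f =1 f'.
Proof.
move=> ef ef' ff'.
have f'f : agree_nearby f' f by move=> W y ? ? ?; apply/esym/(ff' W).
have [rt|nr] := EM (relevant f t); last first.
  have nr' : ~ relevant f' t.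
    by move=> rt; apply: nr; exact: agree_nearby_relevant rt.
  by move=> y; rewrite !extends_irrelevant.
have rt' : relevant f' t by exact: agree_nearby_relevant rt.
apply: (reduced_identity l_gt0 (extends_reduced ef rt) (extends_reduced ef' rt')).
move=> V VT Vk; have [W [WT Wl HW]] := extension_pivot ef rt.
(* Adding the transversal makes [f] depend on [t] and on all of [U] around [q_ U]; this subcube is
   then shrunk to [V]. *)
pose U := V :\ t :|: W.
have UT : U \subset T.
  by rewrite subUset WT andbT subDset.
have Uk : (#|U| <= 2 * l * l + l)%N.
  have [cU _] := leq_card_setU (V :\ t) W; apply: leq_trans cU _.
  by apply: leq_add Wl; apply: leq_trans Vk; exact/subset_leq_card/subD1set.
have VU : V \subset t |: U.
  apply/subsetP=> i iV; rewrite !inE iV andbT.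
  by case: (i == t).
have dU : depends_on f (t |: U) (q_ U).
  move=> i; rewrite in_setU1 => /orP[/eqP ->|iU].
    have [y yq py] := HW U UT (subsetUr _ _); exists y => //.
    by apply: eq_offS yq; exact: subsetUr.
  have iT := subsetP UT i iU.
  have [y yq py] := q_dep UT iU; exists (upd y t c).
    apply: eq_off_upd; first exact: setU11.
    by apply: eq_offS yq; exact: subsetUr.
  by move: py; rewrite /pivotal !(extends_upd _ _ ef).
have [cf _ _] := ef.
have [q qq dV] := depends_on_shrink cf dU VU.
exists q => // y yq; apply: (ff' U) => //.
by apply: eq_off_trans qq; apply: eq_offS yq.
Qed.

(** A list of variables of [W] with their values, padded by [None], and the value of [t]. Repetitive
    or contradictory lists only add harmless points; for fixed [l] the number of codes is polynomial
    in [n]. *)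
Definition nearby_code :=
  ({ffun 'I_(2 * l * l + l) -> option ('I_n * bool)} * bool)%type.

Definition nearby_point (u : nearby_code) : assignment n :=
  [ffun i => if i == t then u.2 else
    if [exists j, u.1 j == Some (i, true)] then true else
    if [exists j, u.1 j == Some (i, false)] then false else
    q_ [set k | [exists j, [exists b, u.1 j == Some (k, b)]]] i].

Lemma nearby_pointP W y : W \subset T -> (#|W| <= 2 * l * l + l)%N ->
  eq_off (t |: W) y (q_ W) -> exists u, nearby_point u = y.
Proof.
move=> WT Wk yq.
pose u1 : {ffun 'I_(2 * l * l + l) -> option ('I_n * bool)} :=
  [ffun j : 'I__ => if (j < #|W|)%N then
     let i := nth t (enum W) j in Some (i, y i) else None].
have uP i b : [exists j, u1 j == Some (i, b)] = (i \in W) && (y i == b).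
  apply/existsP/andP => [[j]|[iW /eqP yi]].
    rewrite ffunE; case: ifP => // jW /eqP[<- <-]; split=> //.
    by rewrite -mem_enum mem_nth // -cardE.
  have iW' : (index i (enum W) < #|W|)%N by rewrite cardE index_mem mem_enum.
  exists (Ordinal (leq_trans iW' Wk)).
  by rewrite ffunE /= iW' nth_index ?mem_enum // yi.
have WE : [set k | [exists j, [exists b, u1 j == Some (k, b)]]] = W.
  apply/setP=> i; rewrite inE; apply/existsP/idP => [[j /existsP[b jb]]|iW].
    have : [exists j, u1 j == Some (i, b)] by apply/existsP; exists j.
    by rewrite uP => /andP[].
  have /existsP[j jb] : [exists j, u1 j == Some (i, y i)] by rewrite uP iW eqxx.
  by exists j; apply/existsP; exists (y i).
exists (u1, y t); apply/ffunP=> i; rewrite ffunE /= !uP WE.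
case: eqP => [-> //|/eqP it].
have [iW|iW] /= := boolP (i \in W); first by case: (y i).
by rewrite yq // in_setU1 negb_or it.
Qed.

Definition nearby_points := [seq nearby_point u | u : nearby_code].

Lemma size_nearby_points :
  size nearby_points = ((n * 2).+1 ^ (2 * l * l + l) * 2)%N.
Proof.
rewrite size_map -cardE card_prod card_ffun card_option card_prod card_bool.
by rewrite !card_ord.
Qed.

End Extension1.
End Extension.

(** * Learning algorithms *)

Section Learning.
Variable n : nat.
Implicit Types (x y z p : assignment n) (C : boolfun n -> Prop).

(** [C] is an arbitrary property, so that answers already received are recorded by narrowing it. *)
Definition identifiable N C := exists A : algorithm n,
  forall f, C f -> run A f = f /\ (num_queries A f <= N)%N.

Lemma identifiableS N N' C C' : (N' <= N)%N -> (forall f, C f -> C' f) ->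
  identifiable N' C' -> identifiable N C.
Proof.
move=> NN CC [A HA]; exists A => f /CC /HA[-> le]; split=> //.
exact: leq_trans NN.
Qed.

Lemma identifiable_unique N C : (forall f f', C f -> C f' -> f = f') ->
  identifiable N C.
Proof.
move=> u; have [[f0 Cf0]|no] := EM (exists f, C f).
  by exists (Output f0) => f Cf; split=> //=; exact: u.
by exists (Output [ffun=> false]) => f Cf; case: no; exists f.
Qed.

Lemma identifiable_ask N C x :
  (forall b, identifiable N (fun f => C f /\ f x = b)) -> identifiable N.+1 C.
Proof.
move=> H; have /exists_choice[A HA] := H.
exists (Ask (Membership x) A) => f Cf /=.
by have [-> le] := HA (f x) f (conj Cf erefl).
Qed.

(** All of [s] is queried; [f0] stands for the pattern of answers, and a pattern that no member of
    [C] realizes needs no further query. *)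
Lemma identifiable_ask_seq N C (s : seq (assignment n)) :
  (forall f0, C f0 ->
     identifiable N (fun f => C f /\ forall x, x \in s -> f x = f0 x)) ->
  identifiable (N + size s)%N C.
Proof.
elim: s C => [|x s IH] C H.
  rewrite addn0; have [[f0 Cf0]|no] := EM (exists f, C f).
    by apply: identifiableS (H f0 Cf0) => // f Cf; split.
  by apply: identifiable_unique => f f' Cf; case: no; exists f.
rewrite addnS; apply: (@identifiable_ask _ _ x) => b; apply: IH => f0 [Cf0 fx].
apply: identifiableS (H f0 Cf0) => // f [[Cf fxb] fs]; split=> // z.
by rewrite in_cons => /orP[/eqP ->|/fs //]; rewrite fxb fx.
Qed.

End Learning.

(** * The learner for bounded gate arity *)

Section Learner.
Variables (R : realType) (l n : nat).
Hypothesis l_gt0 : (0 < l)%N.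
Implicit Types (x y z p : assignment n) (C : boolfun n -> Prop).
Implicit Types (T : {set 'I_n}) (h : assignment n -> bool).
Notation reducible := (@reducible R l n).

(** The state of the learner: [h] is the known restriction of the target to the subcube where the
    variables outside [T] are fixed as in [p]. *)
Definition projects_to C p T h : boolfun n -> Prop :=
  fun f => C f /\ forall y, f (override T y p) = h y.

Definition known T h := reducible h /\ (forall i, i \in T <-> relevant h i).

(** The number of nearby points, all queried when a variable is freed. *)
Definition step_cost := ((n * 2).+1 ^ (2 * l * l + l) * 2)%N.

Definition assign p (s : seq 'I_n) (v : bool) : assignment n :=
  [ffun i => if i \in s then v else p i].

(** The answers at the nearby points determine the restriction with [t] freed. Either [t] is
    relevant to it and joins [T], or the restriction is still [h] after [t] is flipped in [p]. *)
Lemma identifiable_free_variable C p T h t N : t \notin T ->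
  (forall f, C f -> reducible f) -> known T h ->
  (forall h', known (t |: T) h' -> identifiable N (projects_to C p (t |: T) h')) ->
  identifiable N (projects_to C (upd p t (~~ p t)) T h) ->
  identifiable (N + step_cost) (projects_to C p T h).
Proof.
move=> tT Cred [ch Trel] grow flip.
have /exists_choice[q_ q_dep] : forall W : {set 'I_n}, exists q,
    W \subset T -> depends_on h W q.
  move=> W; have [WT|_] := boolP (W \subset T); last by exists p.
  have [W0|W0] := eqVneq W set0.
    by exists p => _ w; rewrite W0 inE.
  have T0 : T != set0 by apply: contraNneq W0 => T0; rewrite -subset0 -T0.
  have [q dq] := reduced_depends_on (reducible_reduced ch T0 Trel) WT.
  by exists q.
pose proj (f : boolfun n) y : bool := f (override (t |: T) y p).
have ext f : projects_to C p T h f -> extends R l T h t (p t) (proj f).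
  move=> [/Cred cf fh]; split.
  - apply: reducible_ext (reducible_override (~: (t |: T)) p cf) => y.
    rewrite /proj; congr (f _); apply/ffunP=> i; rewrite !ffunE in_setC.
    by case: (i \in _).
  - move=> x y xy; rewrite /proj; congr (f _); apply/ffunP=> i; rewrite !ffunE.
    by case: ifP => // /xy.
  - move=> y; rewrite /proj -fh; congr (f _); apply/ffunP=> i.
    rewrite !ffunE in_setU1.
    by have [->|] := eqVneq i t; rewrite /= ?(negPf tT).
pose s := [seq override (t |: T) y p | y <- nearby_points l t q_].
have <- : size s = step_cost by rewrite size_map size_nearby_points.
apply: identifiable_ask_seq => f0 D0; have e0 := ext f0 D0.
have same f : projects_to C p T h f /\ (forall x, x \in s -> f x = f0 x) ->
    proj f =1 proj f0.
  move=> [Df fs]; apply: (extension_identity l_gt0 tT Trel q_dep (ext f Df) e0).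
  move=> W y WT Wk yq; apply: fs; apply: map_f.
  have [u <-] := nearby_pointP WT Wk yq.
  by apply: map_f; rewrite mem_enum.
have [rt|nr] := EM (relevant (proj f0) t).
  apply: identifiableS (grow (proj f0) _) => // [f Df|].
    by have sf := same f Df; case: Df => -[Cf _] _; split.
  split; first by have [] := e0.
  by move=> i; exact: (extends_relevant tT Trel i e0 rt).
apply: identifiableS flip => // f Df; have sf := same f Df.
have [[Cf fh] _] := Df; split=> // y.
rewrite -(extends_irrelevant e0 nr y).
have -> : override T y (upd p t (~~ p t)) = override (t |: T) (upd y t (~~ p t)) p.
  apply/ffunP=> i; rewrite !ffunE in_setU1.
  by have [->|] := eqVneq i t; rewrite /= ?(negPf tT).
apply: etrans (sf _) _.
by rewrite (extends_irrelevant e0 nr) (extends_irrelevant e0 nr);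
   apply: relevant_supported => i /Trel iT; rewrite upd_neq //;
   apply: contraNneq tT => <-.
Qed.

(** A sweep along [s], abandoned in favour of [grow] once a variable turns out relevant. Variables
    in [T] or already at [v] cost nothing. *)
Lemma identifiable_assign C T h v (s : seq 'I_n) p N :
  (forall f, C f -> reducible f) -> known T h ->
  (forall h' t p', t \notin T -> known (t |: T) h' ->
     identifiable N (projects_to C p' (t |: T) h')) ->
  identifiable N (projects_to C (assign p s v) T h) ->
  identifiable (N + size s * step_cost) (projects_to C p T h).
Proof.
move=> Cred kh grow; elim: s p => [|t s IH] p H.
  rewrite addn0; apply: identifiableS H => // f.
  by have -> : assign p [::] v = p by apply/ffunP=> i; rewrite ffunE.
have H' : identifiable N (projects_to C (assign (upd p t v) s v) T h).
  apply: identifiableS H => // f.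
  have -> // : assign (upd p t v) s v = assign p (t :: s) v.
  apply/ffunP=> i; rewrite !ffunE in_cons.
  by case: (i == t); case: (i \in s).
have {IH H'}IH := IH _ H'.
have [ptv|ptv] := eqVneq (p t) v.
  rewrite upd_idem // in IH; apply: identifiableS IH => //=; lia.
have [tT|tT] := boolP (t \in T).
  apply: identifiableS IH => /= [|f [Cf fh]]; first by lia.
  split=> // y; rewrite -fh; congr (f _); apply/ffunP=> i; rewrite !ffunE.
  by have [->|] := eqVneq i t; rewrite ?tT.
have -> : (N + size (t :: s) * step_cost = N + size s * step_cost + step_cost)%N.
  by rewrite /=; lia.
apply: (identifiable_free_variable tT) => // [h' kh'|].
  by apply: identifiableS (grow h' t p tT kh') => //; lia.
by have -> : ~~ p t = v by move: ptv; case: (p t); case: (v).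
Qed.

Definition corner (v : bool) : assignment n := [ffun=> v].

(* If no variable outside [T] ever turns out relevant while all of them are
   raised to 1 and then lowered to 0, monotonicity makes them all fictitious. *)
Lemma identifiable_known C T h p : (forall f, C f -> reducible f) -> known T h ->
  identifiable ((n - #|T|).+1 * (2 * n * step_cost)) (projects_to C p T h).
Proof.
have [k] := ubnP (n - #|T|); elim: k C T h p => // k IH C T h p Tk Cred kh.
pose M := ((n - #|T|) * (2 * n * step_cost))%N.
have grow C' h' t p' : (forall f, C' f -> reducible f) -> t \notin T ->
    known (t |: T) h' -> identifiable M (projects_to C' p' (t |: T) h').
  move=> C'red tT kh'.
  have cT : #|t |: T| = #|T|.+1 by rewrite cardsU1 tT.
  have Tn : (#|t |: T| <= n)%N by rewrite -[n in (_ <= n)%N]card_ord max_card.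
  have lt : (n - #|t |: T| < n - #|T|)%N.
    by move: Tn; rewrite cT; move: #|T| => d; lia.
  apply: identifiableS (IH C' _ h' p' (leq_trans lt Tk) C'red kh') => //.
  by rewrite /M leq_mul2r lt orbT.
have assignE p' v : assign p' (enum 'I_n) v = corner v.
  by apply/ffunP=> i; rewrite !ffunE mem_enum.
have sz : size (enum 'I_n) = n by rewrite size_enum_ord.
(* What the raising sweep has shown is kept in the class during the lowering sweep. *)
pose C1 := projects_to C (corner true) T h.
have C1red f : C1 f -> reducible f by case=> /Cred.
have low : identifiable (M + n * step_cost) (projects_to C1 (corner true) T h).
  rewrite -[n in (n * _)%N]sz.
  apply: (@identifiable_assign _ _ _ false) => // [h' t p' ? ?|].
    exact: grow.
  rewrite assignE; apply: identifiable_unique => f f' [[Cf f1] f0] [[Cf' f1'] f0'].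
  (* [y] lies between its two copies with all variables outside [T] at 0 and at 1, and [g] has the
     value [h y] at both. *)
  suff sq g : C g -> (forall y, g (override T y (corner true)) = h y) ->
      (forall y, g (override T y (corner false)) = h y) -> forall y, g y = h y.
    by apply/ffunP=> y; rewrite !sq.
  move=> /Cred /reducible_monotone mg g1 g0 y.
  apply/idP/idP => [gy|hy].
    rewrite -g1; apply: mg gy => i; rewrite !ffunE; by case: ifP.
  by move: hy; rewrite -g0; apply: mg => i; rewrite !ffunE; case: ifP.
have high : identifiable (M + n * step_cost + n * step_cost) (projects_to C p T h).
  rewrite -[n in (_ + n * _)%N]sz; apply: (@identifiable_assign _ _ _ true) => //.
    move=> h' t p' tT kh'; apply: identifiableS (grow C h' t p' Cred tT kh') => //.
    exact: leq_addr.
  rewrite assignE; apply: identifiableS low => //.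
  by move=> f [Cf fh]; split.
apply: identifiableS high => //; rewrite /M; lia.
Qed.

(** One query at the all-0 point provides the start, with [T] empty and [h] constant. *)
Theorem identifiable_reducible C : (forall f, C f -> reducible f) ->
  identifiable (n.+1 * (2 * n * step_cost)).+1 C.
Proof.
move=> Cred; apply: (@identifiable_ask _ _ _ (corner false)) => b.
have kb : known set0 (fun=> b).
  split; first by left; exists b.
  by move=> i; rewrite inE; split=> // -[y]; rewrite /pivotal eqxx.
have := identifiable_known (corner false) Cred kb.
rewrite cards0 subn0; apply: identifiableS => // f [Cf fb].
by split=> // y; rewrite override0.
Qed.

End Learner.

Lemma uniq_flatten_map (I : eqType) (V : eqType) (F : I -> seq V) (s : seq I) :
  uniq (flatten [seq F i | i <- s]) ->
  {in s, forall i, uniq (F i)} /\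
  {in s &, forall i j, i != j -> forall v, v \in F i -> v \notin F j}.
Proof.
elim: s => [|k s IH] /=; first by split=> // i; rewrite in_nil.
rewrite cat_uniq => /and3P[uk dk /IH[us ds]].
have dks j v : j \in s -> v \in F j -> v \notin F k.
  move=> js vj; apply: contra dk => vk; apply/hasP; exists v => //.
  by apply/flatten_mapP; exists j.
split=> [i|i j]; rewrite !in_cons; first by case/orP=> [/eqP ->|/us].
move=> /orP[/eqP ->|si] /orP[/eqP ->|sj]; rewrite ?eqxx // => ij v.
- by apply: contraL; exact: dks.
- exact: dks.
- exact: ds.
Qed.

(** * From read-once formulas to the polynomial bound *)

Section ReadOnceFormulas.
Variables (R : realType) (B : set gate) (l n : nat).
Hypothesis B_threshold : forall g, B g -> monotone_threshold R g.
Hypothesis B_arity : forall g, B g -> (tag g <= l)%N.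

Lemma formula_reduced (F : formula B n) : uniq (occurrences F) ->
  trivial_or_reduced R l [set i in occurrences F] (eval F).
Proof.
elim: F => [i _|g Bg Fs IH] /=.
  right; exists [set i]; first by rewrite sub1set !inE.
  exact: (@ReducedVar _ _ _ _ _ i).
move=> /uniq_flatten_map[uF dF].
have := @trivial_or_reduced_gate R l n (tag g) (tagged g)
  (fun i => [set j in occurrences (Fs i)]) (fun i => eval (Fs i))
  (fun x => tagged g [ffun i => eval (Fs i) x]) (B_arity Bg) (B_threshold Bg).
move=> H; apply: trivial_or_reducedS (H _ _ _) => //.
- apply/bigcupsP=> i _; apply/subsetP=> j; rewrite !inE => ji.
  by apply/flatten_mapP; exists i; rewrite ?mem_enum.
- by move=> i; apply: IH; apply: uF; rewrite mem_enum.
- move=> i j ij; rewrite -setI_eq0; apply/eqP/setP=> v; rewrite !inE.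
  apply/negP => /andP[vi]; apply/negP.
  by apply: dF vi; rewrite ?mem_enum.
Qed.

Lemma read_once_reducible (f : boolfun n) : read_once B n f ->
  reducible R l f.
Proof.
move=> [F [uF fF]]; apply: (@reducible_ext _ _ _ (eval F)) => //.
by apply: trivial_or_reducedS (formula_reduced uF); exact: subsetT.
Qed.

End ReadOnceFormulas.

Lemma finite_gate_arity (B : set gate) : finite_set B ->
  exists2 l, (0 < l)%N & forall g, B g -> (tag g <= l)%N.
Proof.
(* The successor keeps [l] positive even if there is no gate of positive arity. *)
move=> /finite_seqP[s sB]; exists (\max_(g <- s) tag g).+1 => // g.
rewrite sB /= => gs; apply: leqW.
exact: (@leq_bigmax_seq _ _ xpredT (fun g : gate => tag g)).
Qed.

Lemma read_once_polynomial (R : realType) (B : set gate) : finite_set B ->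
  (forall g, B g -> monotone_threshold R g) ->
  exists P : {poly R}, forall n : nat, exists A : algorithm n,
    exactly_identifies A (read_once B n) /\
    forall f : boolfun n, read_once B n f -> (num_queries A f)%:R <= P.[n%:R].
Proof.
move=> /finite_gate_arity[l l0 Bl] Bt.
(* The query bound of [identifiable_reducible], with [step_cost] unfolded, read as a polynomial in
   [n]; its exponent depends on [l] only. *)
exists (('X + 1%:P) *
  (2%:P * 'X * (('X * 2%:P + 1%:P) ^+ (2 * l * l + l) * 2%:P)) + 1%:P).
move=> n; have [|A HA] := @identifiable_reducible R l n l0 (read_once B n).
  by move=> f; exact: read_once_reducible.
exists A; split=> [f /HA[]//|f /HA[_ le]].
apply: le_trans (_ : (n.+1 * (2 * n * step_cost l n)).+1%:R <= _).
  by rewrite ler_nat.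
rewrite /step_cost -[(_ * _).+1]addn1 -[n.+1]addn1 -[(n * 2).+1]addn1.
rewrite natrD !natrM natrX !natrD natrM.
by rewrite !(hornerD, hornerM, horner_exp, hornerX, hornerC).
Qed.

(** * The lower bound *)

Section LowerBound.
Variables (R : realType) (n k : nat).
Implicit Types (x y a : assignment n) (f : boolfun n).

Definition weight x := #|[set i | x i]|.

Definition slice : boolfun n := [ffun x => k < weight x]%N.

Definition slice_with a : boolfun n := [ffun x => slice x || (x == a)].

Lemma weight_le x y : (forall i, x i -> y i) -> (weight x <= weight y)%N.
Proof.
by move=> xy; apply/subset_leq_card/subsetP=> i; rewrite !inE; exact: xy.
Qed.

Lemma weight_lt x y : (forall i, x i -> y i) -> x != y -> (weight x < weight y)%N.
Proof.
move=> xy; apply: contraNltn => le.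
have /eqP/setP e : [set i | x i] == [set i | y i].
  rewrite eqEcard le andbT; apply/subsetP=> i; rewrite !inE; exact: xy.
by apply/eqP/ffunP=> i; have := e i; rewrite !inE.
Qed.

(* Weights [k + 1] on [a] and [k] elsewhere, with threshold [k * (k + 1)]. *)
Lemma slice_with_threshold a : weight a = k -> threshold_gate R (slice_with a).
Proof.
move=> ak; exists (k * k.+1)%:R, (fun i => (k + a i)%:R); split=> [i|x].
  exact: ler0n.
under eq_bigr => i _ do rewrite -natrM.
rewrite -natr_sum ler_nat.
have -> : (\sum_(i < n) (k + a i) * x i = k * weight x + #|[set i | x i && a i]|)%N.
  rewrite /weight -!sum1_card big_distrr /=.
  rewrite [X in (X + _)%N]big_mkcond [X in (_ + X)%N]big_mkcond -big_split /=.
  apply: eq_bigr => i _; rewrite !inE.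
  by case: (x i); case: (a i); rewrite ?muln1 ?muln0 ?addn0.
have ca : (#|[set i | x i && a i]| <= weight x)%N.
  by apply/subset_leq_card/subsetP=> i; rewrite !inE => /andP[].
rewrite !ffunE; split=> [/orP[lt|/eqP ->]|].
- by apply: leq_trans (leq_addr _ _); rewrite leq_mul2l lt orbT.
- have -> : [set i | a i && a i] = [set i | a i].
    by apply/setP=> i; rewrite !inE andbb.
  by rewrite -/(weight a) ak mulnS addnC.
(* A point of weight below [k] falls short even with weight [k + 1] on all its ones; a point of
   weight [k] other than [a] shares fewer than [k] ones with [a]. *)
apply: contraTT; rewrite negb_or -leqNgt => /andP[xk xa]; rewrite -ltnNge.
have [xk'|xk'] := ltnP (weight x) k.
  move: ca xk'; move: (weight x) #|_| => u v vu uk.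
  apply: leq_ltn_trans (_ : k * u + u < _)%N; first by rewrite leq_add2l.
  nia.
have {xk xk'}xk : weight x = k by apply/eqP; rewrite eqn_leq xk.
rewrite xk; suff : (#|[set i | x i && a i]| < k)%N by lia.
rewrite ltn_neqAle -[X in (_ <= X)%N]xk ca andbT.
apply: contra xa => /eqP c.
have sx : [set i | x i && a i] = [set i | x i].
  apply/eqP; rewrite eqEcard -/(weight x) xk c leqnn andbT.
  by apply/subsetP=> i; rewrite !inE => /andP[].
have sa : [set i | x i && a i] = [set i | a i].
  apply/eqP; rewrite eqEcard -/(weight a) ak c leqnn andbT.
  by apply/subsetP=> i; rewrite !inE => /andP[].
by apply/eqP/ffunP=> i; have := in_set a i; rewrite -[in LHS]sa sx inE.
Qed.

Lemma slice_threshold : threshold_gate R slice.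
Proof.
exists k.+1%:R, (fun=> 1); split=> [i|x]; first exact: ler01.
under eq_bigr => i _ do rewrite mul1r.
rewrite -natr_sum ler_nat ffunE /weight.
suff -> : (\sum_(i < n) x i = #|[set i | x i]|)%N by [].
rewrite -sum1_card [RHS]big_mkcond /=; apply: eq_bigr => i _.
by rewrite inE; case: (x i).
Qed.

Lemma threshold_read_once (g : boolfun n) : threshold_gate R g ->
  read_once (monotone_threshold R) n g.
Proof.
move=> tg; exists (@App (monotone_threshold R) n (existT _ n g) tg (@Var _ n)).
split=> [|x] /=; last first.
  by congr (g _); apply/ffunP=> i; rewrite ffunE.
have -> : flatten [seq [:: i] | i <- enum 'I_n] = enum 'I_n by exact: flatten_seq1.
exact: enum_uniq.
Qed.

Lemma projection_constP f (p : partial_assignment n) b :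
  reflect (forall y : {ffun free_var p -> bool}, f (fill y) = b)
    (projection f p == [ffun=> b]).
Proof.
apply: (iffP eqP) => [/ffunP e y|e]; first by have := e y; rewrite !ffunE.
by apply/ffunP=> y; rewrite !ffunE.
Qed.

Lemma fill_corner (p : partial_assignment n) (y : {ffun free_var p -> bool}) i :
  (fill [ffun _ : free_var p => false] i -> fill y i) /\
  (fill y i -> fill [ffun _ : free_var p => true] i).
Proof. by rewrite !ffunE; case: insub => // u; rewrite !ffunE. Qed.

(* Only the least and the greatest point of the subcube matter. *)
Lemma answer_slice_with (q : query n) : exists2 U : {set assignment n},
  (#|U| <= 2)%N & forall a, weight a = k -> a \notin U ->
    answer (slice_with a) q = answer slice q.
Proof.
case: q => [x|p].
  exists [set x]; first by rewrite cards1.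
  by move=> a _; rewrite inE /= !ffunE eq_sym => /negPf ->; rewrite orbF.
pose lo := fill [ffun _ : free_var p => false].
pose hi := fill [ffun _ : free_var p => true].
exists [set lo; hi]; first by rewrite cards2; case: (_ != _).
move=> a ak; rewrite !inE negb_or => /andP[alo ahi] /=.
(* If [a] is in the subcube but is neither of its extreme points, these have weight below and above
   [k], so both functions are 0 at the least point and 1 at the greatest. *)
congr (_ || _); apply/projection_constP/projection_constP => H y.
- by have := H y; rewrite [slice_with a _]ffunE => /negbT/norP[/negPf].
- rewrite [slice_with a _]ffunE H; apply/negbTE/negP => /eqP ya.
  have := H [ffun=> true]; rewrite [slice _]ffunE => /negbT; rewrite -leqNgt -ak.
  rewrite leqNgt weight_lt //.
  by move=> i; rewrite -ya => /(fill_corner y i).2.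
- have := H y; rewrite [slice_with a _]ffunE => /orP[//|/eqP ya].
  have := H [ffun=> false]; rewrite [slice_with a _]ffunE.
  move=> /orP[|/eqP la]; last first.
    by rewrite -la eqxx in alo.
  rewrite [slice _]ffunE ltnNge -ak weight_le // => i.
  by rewrite -ya => /(fill_corner y i).1.
- by have := H y; rewrite [slice_with a _]ffunE => ->.
Qed.

(** Adversary argument: [U] collects, along the run on [slice], the at most two points that each
    query can tell apart. *)
Lemma run_slice_with (A : algorithm n) : exists2 U : {set assignment n},
  (#|U| <= 2 * num_queries A slice)%N & forall a, weight a = k -> a \notin U ->
    run A (slice_with a) = run A slice.
Proof.
elim: A => [h|q next IH] /=; first by exists set0; rewrite ?cards0.
have [U U2 HU] := answer_slice_with q; have [V V2 HV] := IH (answer slice q).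
exists (U :|: V).
  have [c _] := leq_card_setU U V; rewrite mulnS.
  exact: leq_trans c (leq_add _ _).
move=> a ak; rewrite in_setU negb_or => /andP[aU aV].
by rewrite HU // HV.
Qed.

Lemma card_weight : ('C(n, k) <= #|[set a | weight a == k]|)%N.
Proof.
rewrite -[n in 'C(n, _)]card_ord -card_draws.
have inj : injective (fun S : {set 'I_n} => [ffun i => i \in S] : assignment n).
  by move=> S S' /ffunP e; apply/setP=> i; have := e i; rewrite !ffunE.
rewrite -(card_imset _ inj); apply/subset_leq_card/subsetP=> a /imsetP[S].
rewrite !inE => /eqP <- ->; rewrite /weight; apply/eqP/eq_card => i.
by rewrite inE ffunE.
Qed.

(** A point [a] of weight [k] outside [U] would give [slice] and [slice_with a] the same output
    although they differ at [a]. *)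
Lemma slice_queries (A : algorithm n) :
  exactly_identifies A (read_once (monotone_threshold R) n) ->
  ('C(n, k) <= 2 * num_queries A slice)%N.
Proof.
move=> HA; apply: leq_trans card_weight _.
have [U U2 HU] := run_slice_with A; apply: leq_trans U2.
apply/subset_leq_card/subsetP=> a; rewrite inE => /eqP ak.
apply/negPn/negP => /(HU a ak).
rewrite !HA; [|exact/threshold_read_once/slice_threshold
  |exact/threshold_read_once/slice_with_threshold].
by move=> /ffunP/(_ a); rewrite !ffunE eqxx orbT ak ltnn.
Qed.

End LowerBound.

(** By Pascal's rule, raising [n] by two and [h] by one at least doubles the binomial
    coefficient. *)
Lemma exp2_le_binomial n h : (2 * h <= n)%N -> (2 ^ h <= 'C(n, h))%N.
Proof.
elim: h n => [|h IH] n; first by rewrite bin0.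
case: n => [|[|n]] hn; [lia | lia |].
have {IH}IH : (2 ^ h <= 'C(n, h))%N by apply: IH; lia.
rewrite binS binS (leq_trans (n := 'C(n, h) + 'C(n, h))%N) //.
  by rewrite addnn -mul2n expnS leq_mul2l IH.
have le : ('C(n, h) <= 'C(n.+1, h))%N.
  by case: (h) => [|h']; rewrite ?bin0 // binS leq_addr.
exact: leq_add (leq_addl _ _) le.
Qed.

Lemma read_once_exponential (R : realType) :
  exists c : R, 1 < c /\
    exists N : nat, forall n : nat, (N <= n)%N ->
      forall A : algorithm n,
        exactly_identifies A (read_once (monotone_threshold R) n) ->
        exists f : boolfun n,
          read_once (monotone_threshold R) n f /\
          c ^+ n <= (num_queries A f)%:R.
Proof.
have c1 : 1 < 17 / 16 :> R by lra.
(* The count is at least [2 ^ (n./2).-1]. The eighth power of 17/16 is at most 2, and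
   [n <= 8 * (n./2).-1] holds from 4 on. *)
exists (17 / 16); split=> //; exists 4 => n n4 A HA.
exists (slice n n./2); split.
  exact/threshold_read_once/slice_threshold.
have := slice_queries n./2 HA; set Q := num_queries _ _.
have h2 : (2 * n./2 <= n)%N by lia.
move/(leq_trans (exp2_le_binomial h2)).
have -> : (2 ^ n./2 = 2 * 2 ^ (n./2).-1)%N by rewrite -expnS prednK //; lia.
rewrite leq_mul2l /= => le.
apply: le_trans (_ : (17 / 16) ^+ (8 * (n./2).-1) <= _).
  by apply: ler_weXn2l; [exact: ltW|lia].
apply: le_trans (_ : 2 ^+ (n./2).-1 <= _).
  rewrite exprM; apply: lerXn2r; rewrite ?nnegrE //; first by apply: exprn_ge0; lra.
  by lra.
by rewrite -natrX ler_nat.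
Qed.

Local Open Scope classical_set_scope.

Theorem theorem4 (R : realType) :
  (exists c : R, 1 < c /\
    exists N : nat, forall n : nat, (N <= n)%N ->
      forall A : algorithm n,
        exactly_identifies A (read_once (monotone_threshold R) n) ->
        exists f : boolfun n,
          read_once (monotone_threshold R) n f /\
          c ^+ n <= (num_queries A f)%:R)
  /\
  (forall B : set gate, finite_set B -> B `<=` monotone_threshold R ->
    exists P : {poly R}, forall n : nat,
      exists A : algorithm n,
        exactly_identifies A (read_once B n) /\
        forall f : boolfun n, read_once B n f ->
          (num_queries A f)%:R <= P.[n%:R]).
Proof.
split; first exact: read_once_exponential.
by move=> B fB Bt; exact: read_once_polynomial fB Bt.
Qed.
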